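(* Let $\gamma>1$ and $c>2$ be any constants. For all integers $n>d$ and $k>5c^2/(c-2)$, $\mathsf{ANNS}^{\gamma}_{d,n}$ has a $k$-round randomized cell-probing scheme with $O\!\left(k+\left(\tfrac{1}{k}\log d\right)^{c/k}\right)$ cell-probes in total, table size $n^{O(1)}$, and word size $O(d)$.
   Context: $\mathsf{ANNS}^{\gamma}_{d,n}$ (approximate nearest neighbor search in Hamming space): a database $B\subseteq\{0,1\}^d$ with $|B|=n$ is preprocessed into a table; given a query $x\in\{0,1\}^d$, the answer must be a point $z\in B$ with $\mathrm{dist}(x,z)\le\gamma\cdot\mathrm{dist}(x,y)$ for all $y\in B$, where $\mathrm{dist}$ is Hamming distance. In the cell-probe model, each database is stored as a table of $s$ cells (table size) of $w$ bits each (word size). A $k$-round cell-probing algorithm is given by lookup functions $L_1,\dots,L_k$ and an output function: in round $i$, $L_i$ maps the query and the addresses and contents of all cells probed in earlier rounds to a list of $t_i$ addresses probed in parallel; the output function maps the query and all probed addresses/contents to the answer. The number of cell-probes in total is $t=\sum_i t_i$. In a randomized cell-probing scheme the table is a deterministic function of the database, the algorithm may use private random bits, and for every query and every database it outputs a correct answer with probability at least $2/3$. Logarithms are binary; constants hidden in $O(\cdot)$ may depend on $\gamma$ and $c$. *)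

(* Defs.v *)
From mathcomp Require Import all_boot all_order all_algebra.
From mathcomp Require Import reals exp.

Set Implicit Arguments.
Unset Strict Implicit.
Unset Printing Implicit Defensive.

Import Order.TTheory GRing.Theory Num.Theory.

Local Open Scope ring_scope.

Definition log2 (R : realType) (x : R) : R := ln x / ln 2.

Notation point d := (d.-tuple bool).

Definition hdist (d : nat) (x y : point d) : nat :=
  #|[set i : 'I_d | tnth x i != tnth y i]|.

Definition database (d n : nat) : Type := {B : {set point d} | #|B| == n}.

Definition anns_correct (R : realType) (gamma : R) (d n : nat)
    (x : point d) (B : database d n) (z : point d) : bool :=
  (z \in val B) &&
  [forall y in val B, (hdist x z)%:R <= gamma * (hdist x y)%:R].

Notation word w := (w.-tuple bool).

Definition cell_table (s w : nat) : Type := 'I_s -> word w.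

(* Addresses and contents of the probed cells, in order of probing.  The rounds
   are concatenated; as round [i] always makes [t i] probes, the boundaries
   between rounds can be recovered. *)
Definition history (s w : nat) : Type := seq ('I_s * word w).

Record algorithm (Q A : Type) (k s w : nat) (t : 'I_k -> nat) := Algorithm {
  lookup : forall i : 'I_k, Q -> history s w -> (t i).-tuple 'I_s;
  output : Q -> history s w -> A
}.

Definition transcript (Q A : Type) (k s w : nat) (t : 'I_k -> nat)
    (alg : algorithm Q A s w t) (T : cell_table s w) (x : Q) : history s w :=
  foldl (fun (h : history s w) (i : 'I_k) =>
           h ++ [seq (a, T a) | a <- lookup alg i x h])
        [::] (enum 'I_k).

Definition run (Q A : Type) (k s w : nat) (t : 'I_k -> nat)
    (alg : algorithm Q A s w t) (T : cell_table s w) (x : Q) : A :=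
  output alg x (transcript alg T x).

(* The private random bits are read by the algorithm only: neither the table nor
   the numbers of probes [probes i] depend on them. *)
Record randomized_scheme (Q D A : Type) (k s w : nat) := RandomizedScheme {
  coins : nat;
  probes : 'I_k -> nat;
  preprocess : D -> cell_table s w;
  algo : coins.-tuple bool -> algorithm Q A s w probes
}.

Arguments algo {Q D A k s w} _ _.

Definition total_probes (Q D A : Type) (k s w : nat)
    (S : randomized_scheme Q D A k s w) : nat :=
  (\sum_(i < k) probes S i)%N.

Definition success_prob (R : realType) (Q D A : Type) (k s w : nat)
    (S : randomized_scheme Q D A k s w) (correct : Q -> D -> A -> bool)
    (x : Q) (y : D) : R :=
  #|[set r : (coins S).-tuple bool |
       correct x y (run (algo S r) (preprocess S y) x)]|%:R
  / #|{: (coins S).-tuple bool}|%:R.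

Definition solves (R : realType) (Q D A : Type) (k s w : nat)
    (S : randomized_scheme Q D A k s w) (correct : Q -> D -> A -> bool) : Prop :=
  forall (x : Q) (y : D), 2 / 3 <= success_prob R S correct x y.

(* Main.v *)
(* The search runs over [L = 2 ^ Lam = O(log d)] levels of geometrically growing radius.
   Random parities of sampled coordinates give, at each level [u], a set [C_u] of
   candidates lying between the balls of radii [u] and [u + 1] around the query, and
   decidable from [O(log n)] bits; a table indexed by the sketch of the query stores
   a point of [C_u].  Shorter sketches, of [O((log n) / h + log L)] bits, misclassify at
   most a fraction [n ^ (- 1 / h)] of [C_u]; as [h] of them fit in one address, one cell
   locates among [h] levels [j] the first at which a non-negligible part of [C_u]
   is close to the query.  Hence every round either divides the gap between an empty
   level and a non-empty one by [tau], or divides the number of candidates by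
   [n ^ (1 / h)]; the test deciding which one happens is made in parallel with the
   probes of the following round, so a phase costs a single round and, with
   [h ~ k / 2], [tau ~ (log d) ^ (2 / k)] suffices.
   Finally, the public coins are replaced by a random sample of polynomially many
   seeds, good for all queries and databases at once. *)
Require Import Defs.
From mathcomp Require Import all_boot all_order all_algebra.
From mathcomp Require Import reals sequences exp.
From mathcomp Require Import zify ring lra.

Set Implicit Arguments.
Unset Strict Implicit.
Unset Printing Implicit Defensive.

Import Order.TTheory GRing.Theory Num.Theory.

(** * Words, and cell-probing algorithms run as state machines *)

Lemma word_encoding (A : finType) (a0 : A) (w : nat) :
  #|A| <= 2 ^ w ->
  exists (enc : A -> word w) (dec : word w -> A), cancel enc dec.
Proof.
have -> : 2 ^ w = #|{: word w}| by rewrite card_tuple card_bool.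
move=> leAw.
pose enc (a : A) : word w := enum_val (widen_ord leAw (enum_rank a)).
exists enc, (fun v => odflt a0 [pick a | enc a == v]) => a.
case: pickP => [b /eqP /enum_val_inj eq_ba | /(_ a)]; last by rewrite eqxx.
by apply: enum_rank_inj; apply: val_inj; have := congr1 val eq_ba.
Qed.

Section Machine.

Variables (Q A St : Type) (k s w t : nat).
Variables (init : St) (query : Q -> St -> t.-tuple 'I_s).
Variables (step : St -> seq (word w) -> St) (out : St -> A).

(** An [algorithm] has no memory between rounds, so the state is rebuilt from the history, [t] cells
    per completed round. *)
Fixpoint replay (m : nat) (h : history s w) : St :=
  if m is m'.+1
  then step (replay m' h) [seq p.2 | p <- take t (drop (m' * t) h)]
  else init.

Lemma replay_cat (m : nat) (h h' : history s w) :
  m * t <= size h -> replay m (h ++ h') = replay m h.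
Proof.
elim: m => //= m IH le_h.
have le_mt : m * t <= size h by apply: leq_trans le_h; rewrite mulSn leq_addl.
rewrite IH // drop_cat; case: ltngtP le_mt => // [lt_h _|eq_h _].
  by rewrite takel_cat // size_drop leq_subRL ?(ltnW lt_h) // addnC -mulSn.
have t0 : t = 0 by lia.
by rewrite t0 !take0.
Qed.

(** Each round adds exactly [t] pairs to the history, so [size h %/ t] counts the completed
    rounds. *)
Definition machine : algorithm Q A s w (fun _ : 'I_k => t) :=
  Algorithm (fun _ x h => query x (replay (size h %/ t) h))
            (fun _ h => out (replay (size h %/ t) h)).

Lemma run_machine (T : cell_table s w) (x : Q) : 0 < t ->
  run machine T x =
  out (iter k (fun st => step st [seq T a | a <- query x st]) init).
Proof.
move=> t_gt0; rewrite /run /= /transcript.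
set F := fun h i => _; set G := fun st => _.
suff H e : size (foldl F [::] e) = size e * t /\
    replay (size e) (foldl F [::] e) = iter (size e) G init.
  have [eq_s eq_r] := H (enum 'I_k).
  by rewrite eq_s mulnK // eq_r size_enum_ord.
elim/last_ind: e => [|e i [IHs IHr]] //.
rewrite size_rcons foldl_rcons; set h := foldl F [::] e in IHs IHr *.
have -> : F h i = h ++ [seq (a, T a) | a <- query x (replay (size h %/ t) h)] by [].
rewrite size_cat size_map size_tuple IHs addnC -mulSn; split=> //=.
rewrite replay_cat ?IHs // mulnK // IHr /G; congr step.
rewrite drop_cat IHs ltnn subnn drop0 take_oversize ?size_map ?size_tuple //.
by rewrite -map_comp.
Qed.

End Machine.

(** * Replacing public coins by a small family of seeds *)

Lemma sum_bool_card (T : finType) (p : pred T) :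
  \sum_x (p x : nat) = #|[set x | p x]|.
Proof. by rewrite -sum1dep_card [RHS]big_mkcond; apply: eq_bigr => x _; case: (p x). Qed.

(* For a uniformly random [F] the mean of [64 ^ #(bad i)] is at most [2 ^ #|I|], whereas
   it is at least [4 ^ #|I|] as soon as a third of the [i] are bad. *)
Lemma few_bad_family (I S U : finType) (bad : U -> S -> bool) :
  0 < #|S| -> (forall u, 64 * #|[set s | bad u s]| <= #|S|) -> #|U| < 2 ^ #|I| ->
  exists F : {ffun I -> S}, forall u, 3 * #|[set i | bad u (F i)]| <= #|I|.
Proof.
move=> S_gt0 few ltU.
pose ub u (F : {ffun I -> S}) := #|I| < 3 * #|[set i | bad u (F i)]|.
have bad_u u : #|[set F | ub u F]| * 2 ^ #|I| <= #|S| ^ #|I|.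
  pose wt s := if bad u s then 64 else 1.
  have moment : \sum_(F : {ffun I -> S}) \prod_i wt (F i) = (\sum_s wt s) ^ #|I|.
    by rewrite -(bigA_distr_bigA (fun=> wt)) prod_nat_const.
  (* At most one [s] in 64 has weight 64, so the mean weight is at most [1 + 63 / 64]. *)
  have sum_wt : \sum_s wt s <= 2 * #|S|.
    have -> : \sum_s wt s = \sum_s (1 + 63 * (bad u s)).
      by apply: eq_bigr => s _; rewrite /wt; case: (bad u s).
    rewrite big_split /= sum1_card -big_distrr /= sum_bool_card.
    by rewrite mul2n -addnn leq_add //; apply: leq_trans (few u); rewrite leq_mul.
  have wtE (F : {ffun I -> S}) : \prod_i wt (F i) = 64 ^ #|[set i | bad u (F i)]|.
    by rewrite -big_mkcond prod_nat_const cardsE.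
  have [I0|I_gt0] := posnP #|I|.
    have -> : [set F | ub u F] = set0; last by rewrite cards0.
    apply/setP=> F; rewrite !inE /ub I0.
    have -> : [set i | bad u (F i)] = set0; last by rewrite cards0.
    apply/eqP; rewrite -cards_eq0 -leqn0; apply: leq_trans (max_card _) _.
    by rewrite I0.
  have low : #|[set F | ub u F]| * 4 ^ #|I| <= (2 * #|S|) ^ #|I|.
    apply: (@leq_trans ((\sum_s wt s) ^ #|I|)); last by rewrite leq_exp2r.
    rewrite -moment (bigID (ub u)) /= -sum_nat_const.
    rewrite [X in X <= _](eq_bigl (ub u)) => [|F]; last by rewrite inE.
    apply: leq_trans (leq_addr _ _); apply: leq_sum => F ubF.
    by rewrite wtE -[64]/(4 ^ 3) -expnM leq_exp2l // ltnW.
  move: low; rewrite expnMn -[4]/(2 * 2) expnMn mulnA [2 ^ _ * #|S| ^ _]mulnC.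
  by rewrite leq_pmul2r ?expn_gt0.
have [F /negP goodF|all_bad] := pickP [pred F | ~~ [exists u, ub u F]].
  exists F => u; rewrite leqNgt; apply/negP => ubF; apply: goodF.
  by apply/existsP; exists u.
(* If every family were bad for some [u], the bad sets would cover all of them; yet each has density
   at most [1 / 2 ^ #|I|], and there are fewer than [2 ^ #|I|] of them. *)
have cover : #|S| ^ #|I| <= \sum_u #|[set F | ub u F]|.
  rewrite -card_ffun -sum1_card.
  rewrite -(eq_bigr _ (fun u _ => sum_bool_card (ub u))).
  rewrite exchange_big; apply: leq_sum => F _.
  have /negbFE/existsP [u ubF] := all_bad F.
  by rewrite (bigD1 u) //= ubF.
suff : #|S| ^ #|I| * 2 ^ #|I| <= #|U| * #|S| ^ #|I|.
  by rewrite mulnC leq_pmul2r ?expn_gt0 ?S_gt0 // leqNgt ltU.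
apply: leq_trans (leq_mul cover (leqnn _)) _.
by rewrite big_distrl /= -sum_nat_const; apply: leq_sum.
Qed.

(** * The search over levels, abstracted from the table *)

Definition sketch_family (d m : nat) (O : finType) :=
  nat -> O -> point d -> m.-tuple bool.

(** The rounding makes [tau.+1] steps overshoot [hi - lo], so [tau] grid points leave no gap longer
    than a step. *)
Definition grid_step (tau lo hi : nat) : nat := ((hi - lo) %/ tau.+1).+1.

Definition grid (tau lo hi i : nat) : nat :=
  minn hi (lo + i.+1 * grid_step tau lo hi).

(** [hv] lists heaviness at the grid levels and [r] is the first heavy one. The shifts by one level
    match the precision of the sketches: a light level [j] bounds [C j.-1], a heavy one makes
    [C j.+1] nonempty. *)
Definition narrow (tau lo hi : nat) (hv : seq bool) : nat * nat :=
  let r := find id hv in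
  (if r is r'.+1 then (grid tau lo hi r').-1 else lo,
   if r < tau then minn hi (grid tau lo hi r).+1 else hi).

(* [(l, v, u, z)]: level [l] has no candidate, level [u] has some, level [v] is
   the next one to be tested, [z] is the latest candidate read from the table. *)
Definition search_state (T : Type) : Type := nat * nat * nat * T.

(** Both answers come from one round, requested before it is known whether level [v] has candidates;
    the right one is selected afterwards. *)
Definition search_step (T : Type) (tau : nat) (st : search_state T)
    (below above : option (T * seq bool)) : search_state T :=
  let: (l, v, u, z) := st in
  if below is Some (z', hv) then
    let: (v', u') := narrow tau l v hv in (l, v', u', z')
  else if above is Some (z', hv) then
    let: (v', u') := narrow tau v u hv in (v, v', u', z')
  else st.

(** Nothing is assumed about the answers: even under a bad seed the levels stay in range, so their
    encoding in addresses is faithful. *)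
Lemma narrow_le (tau lo hi : nat) (hv : seq bool) :
  (narrow tau lo hi hv).1 <= maxn lo hi /\ (narrow tau lo hi hv).2 <= hi.
Proof.
rewrite /narrow /grid /=; split; last by case: ifP => // _; exact: geq_minl.
by case: (find _ _) => [|r]; lia.
Qed.

Section Search.

Variables (T : finType) (C : nat -> {set T}) (wit : nat -> T) (heavy : rel nat).
Variables (tau L e n : nat).

Hypothesis C0 : C 0 = set0.
Hypothesis witP : forall u, C u != set0 -> wit u \in C u.
Hypothesis C_mono : forall u u', u <= u' <= L -> #|C u| <= #|C u'|.
Hypothesis heavyP : forall u j, 0 < j < u -> u <= L -> heavy u j -> C j.+1 != set0.
Hypothesis lightP :
  forall u j, 0 < j <= u -> u <= L -> ~~ heavy u j -> #|C j.-1| * 2 ^ e <= #|C u|.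

Definition answer (lo hi : nat) : option (T * seq bool) :=
  if C hi == set0 then None
  else Some (wit hi, mkseq (fun i => heavy hi (grid tau lo hi i)) tau).

(** The grid level before the first heavy one is light, which bounds [C v]; the heavy one provides a
    candidate at [u]. They are at most a grid step apart, plus one level on either side. At the
    ends, [C lo] is empty and [C hi] is not. *)
Lemma narrow_spec (lo hi v u : nat) :
  0 < tau -> lo < hi <= L -> C lo = set0 -> C hi != set0 ->
  (v, u) = narrow tau lo hi (mkseq (fun i => heavy hi (grid tau lo hi i)) tau) ->
  [/\ lo <= v, v <= u, u <= hi, C u != set0 &
      #|C v| * 2 ^ e <= #|C hi| /\ u - v <= (hi - lo) %/ tau.+1 + 3].
Proof.
move=> tau0 /andP[lt_lh hL] Clo Chi.
rewrite /narrow; set hv := mkseq _ _; set r := find id hv => -[-> ->].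
set s := grid_step tau lo hi.
have s_gt0 : 0 < s by [].
have s_big : hi < lo + tau.+1 * s.
  by rewrite -ltn_subLR ?(ltnW lt_lh) // mulnC; apply: ltn_ceil.
have gridE i : grid tau lo hi i = minn hi (lo + i.+1 * s) by [].
have grid_gt i : lo < grid tau lo hi i by rewrite gridE; lia.
have -> : (hi - lo) %/ tau.+1 + 3 = s + 2 by rewrite /s /grid_step addn3 addn2.
have r_le : r <= tau by rewrite -[leqRHS](size_mkseq (fun i => heavy hi (grid tau lo hi i))) find_size.
have before i : i < r -> ~~ heavy hi (grid tau lo hi i).
  move=> lt_ir; have := before_find false lt_ir.
  by rewrite nth_mkseq ?(leq_trans lt_ir) // => /negbT.
have at_r : r < tau -> heavy hi (grid tau lo hi r).
  move=> lt_r; have := nth_find false (_ : has id hv); rewrite -/r.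
  by rewrite nth_mkseq //; apply; rewrite has_find size_mkseq.
have lightC : #|C (if r is r'.+1 then (grid tau lo hi r').-1 else lo)| * 2 ^ e <= #|C hi|.
  case: (r) before => [|r'] before; first by rewrite Clo cards0.
  apply: lightP => //; last exact: before.
  by rewrite (leq_trans _ (grid_gt r')) //= gridE geq_minl.
have heavyC : C (if r < tau then minn hi (grid tau lo hi r).+1 else hi) != set0.
  case: ifP => // lt_r.
  have [le_hg|lt_gh] := leqP hi (grid tau lo hi r).+1; first by [].
  by apply: heavyP (at_r lt_r) => //; have := grid_gt r; lia.
split=> //.
- by case: (r) => // r'; have := grid_gt r'; lia.
- case: (r) r_le => [|r'] r_le; case: ifP => _ //; try lia.
  + by have := grid_gt 0; lia.
  + by rewrite !gridE; nia.
  + by rewrite gridE; lia.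
- by case: ifP => // _; exact: geq_minl.
- split=> //; case: (r) r_le => [|r'] r_le; rewrite ?gridE; case: ifP => h; try nia.
Qed.

Variables (Lam f : nat).
Hypothesis L_def : L = 2 ^ Lam.
Hypothesis f_gt0 : 0 < f.
Hypothesis tau_ge : 2 ^ f <= tau.

(** [X 1 = L] is the initial gap. The subtraction is truncated, so [X] decreases to [1] and stays
    there. *)
Let X i := 2 ^ (Lam + f - f * i).

(* Each round increments [i] (the gap shrinks) or [sg] (the candidates get fewer). *)
Definition search_inv (i sg : nat) (st : search_state T) : Prop :=
  let: (l, v, u, z) := st in
  [/\ l <= v, v <= u, u <= L, C l = set0 & C u != set0] /\
  [/\ u - l <= X i + 4, u - v <= X i.+1 + 4,
      #|C u| * (2 ^ e) ^ sg <= n & #|C v| * (2 ^ e) ^ sg.+1 <= n].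

Definition bracketed (gap : nat) (z : T) : Prop :=
  exists l u, [/\ C l = set0, z \in C u, l <= u <= L & u <= l + gap].

Definition ideal_step (st : search_state T) : search_state T :=
  let: (l, v, u, z) := st in search_step tau st (answer l v) (answer v u).

(** The additive [4] survives a division: [tau >= 2] and [X i <= tau * X i.+1] give
    [X i + 4 < (X i.+1 + 2) * tau.+1]. *)
Lemma X_shrink i g : g <= X i + 4 -> g %/ tau.+1 + 3 <= X i.+1 + 4.
Proof.
move=> le_g; have tau2 : 2 <= tau by apply: leq_trans tau_ge; rewrite -[2]/(2 ^ 1) leq_exp2l.
have X_tau : X i <= tau * X i.+1.
  apply: leq_trans (leq_mul tau_ge (leqnn _)); rewrite /X -expnD leq_exp2l //; lia.
have : g < (X i.+1 + 2) * tau.+1 by nia.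
by rewrite -ltn_divLR //; lia.
Qed.

(** The level [v], fixed a round ahead, pays for either outcome of its test: if it is empty, the gap
    drops to [u - v]; otherwise it becomes the upper level and has fewer candidates by a factor
    [2 ^ e]. *)
Lemma ideal_step_inv i sg st : search_inv i sg st ->
  (exists i' sg', i' + sg' = (i + sg).+1 /\ search_inv i' sg' (ideal_step st)) /\
  bracketed (X i + 4) (ideal_step st).2.
Proof.
case: st => [[[l v] u] z] [[lv vu uL Cl Cu] [gap1 gap2 cu cv]].
have tau0 : 0 < tau by apply: leq_trans tau_ge; rewrite expn_gt0.
have X_anti : X i.+1 <= X i by rewrite leq_exp2l //; lia.
rewrite /ideal_step /search_step /answer.
case: eqP => [Cv|/eqP Cv].
  rewrite (negbTE Cu).
  have vu' : v < u <= L by rewrite uL ltn_neqAle vu !andbT; apply: contraNneq Cu => <-; rewrite Cv.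
  case E : (narrow _ _ _ _) => [v' u'].
  have [lv' vu1 uu' Cu' [cv' gap']] := narrow_spec tau0 vu' Cv Cu (esym E).
  split; last by exists v, u; split=> //=; [exact: witP | rewrite vu | lia].
  exists i.+1, sg; split; first by []. split; split=> //; try lia.
  - by apply: leq_trans gap' _; apply: X_shrink.
  - by apply: leq_trans cu; rewrite leq_mul // C_mono // uu'.
  - by apply: leq_trans cu; rewrite expnS mulnA leq_mul.
have lv' : l < v <= L.
  rewrite (leq_trans vu) // andbT ltn_neqAle lv andbT.
  by apply: contraNneq Cv => <-; rewrite Cl.
case E : (narrow _ _ _ _) => [v' u'].
have [lv1 vu1 uu' Cu' [cv' gap']] := narrow_spec tau0 lv' Cl Cv (esym E).
split; last by exists l, v; split=> //=; [exact: witP | rewrite lv; lia | lia].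
exists i, sg.+1; split; first by rewrite addnS. split; split=> //; try lia.
- by apply: leq_trans gap' _; apply: X_shrink; lia.
- by apply: leq_trans cv; rewrite leq_mul // C_mono // uu' /=; lia.
- by apply: leq_trans cv; rewrite [_ ^ sg.+2]expnS mulnA leq_mul.
Qed.

(** A nonempty upper level keeps [sg] below [s], so before the last round [i > a] and [X i = 1]; the
    last round then reads a candidate with a bracket of gap [1 + 4]. *)
Lemma search_correct (a s k : nat) (z0 : T) :
  C L != set0 -> #|C L| <= n -> n < (2 ^ e) ^ s -> Lam <= f * a -> a.+1 + s <= k ->
  bracketed 5 (iter k ideal_step (0, 0, L, z0)).2.
Proof.
move=> CL CLn n_lt fa; case: k => [|k] le_k; first by lia.
have [i [sg [eq_k inv]]] : exists i sg, i + sg = k /\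
    search_inv i sg (iter k ideal_step (0, 0, L, z0)).
  elim: k {le_k} => [|k [i [sg [eq_k inv]]]] /=.
    exists 0, 0; split=> //; split; split=> //; rewrite ?C0 ?cards0 ?muln1 //.
      by rewrite subn0 L_def /X muln0 subn0 expnD; nia.
    by rewrite subn0 L_def /X muln1 addnK; lia.
  have [[i' [sg' [eq' inv']]] _] := ideal_step_inv inv.
  by exists i', sg'; rewrite eq' eq_k.
have sg_s : sg < s.
  rewrite ltnNge; apply/negP => le_s.
  case: (iter _ _ _) inv => [[[l v] u] z] [[_ _ _ _ Cu] [_ _ cu _]].
  have : (2 ^ e) ^ s <= n.
    apply: leq_trans cu; rewrite -[leqLHS]mul1n leq_mul // ?card_gt0 //.
    by rewrite leq_pexp2l // expn_gt0.
  by rewrite leqNgt n_lt.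
have [_ [l [u [Cl zu luL gap]]]] := ideal_step_inv inv.
exists l, u; split=> //; apply: leq_trans gap _.
suff -> : X i = 1 by [].
by rewrite /X; have -> : Lam + f - f * i = 0 by nia.
Qed.

End Search.

(** * Good seeds, by union bounds and Markov's inequality *)

Lemma union_bound (I S : finType) (P : I -> pred S) :
  #|[set s | ~~ [forall i, P i s]]| <= \sum_i #|[set s | ~~ P i s]|.
Proof.
rewrite -sum_bool_card (eq_bigr _ (fun i _ => esym (sum_bool_card (fun s => ~~ P i s)))).
rewrite exchange_big; apply: leq_sum => s _.
by case: forallPn => // -[i ni]; rewrite (bigD1 i) //= ni.
Qed.

Section GoodSeeds.

Variables (d n L : nat) (near : nat -> rel (point d)).
Variables (m1 m2 e e1 e2 : nat) (O1 O2 : finType).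
Variables (sk1 : sketch_family d m1 O1) (acc1 : rel (m1.-tuple bool)).
Variables (sk2 : sketch_family d m2 O2) (acc2 : rel (m2.-tuple bool)).

(** Pairs between the two radii may be classified either way; this freedom is what lets short
    sketches work. *)
Definition sketch_err m (O : finType) (sk : sketch_family d m O)
    (acc : rel (m.-tuple bool)) (i : nat) (o : O) (x z : point d) : bool :=
  near i x z && ~~ acc (sk i o x) (sk i o z)
  || ~~ near i.+1 x z && acc (sk i o x) (sk i o z).

(* The query enters only through its sketch [sx], which is part of the cell address.
   Level 0 is a sentinel without candidates. *)
Definition candidates (B : {set point d}) (u : nat) (o : O1) (sx : m1.-tuple bool) :
    {set point d} :=
  if u == 0 then set0 else [set z in B | acc1 sx (sk1 u o z)].

(** The exponent [e.+1] leaves half of the allowed fraction [1 / 2 ^ e] to misclassified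
    candidates. *)
Definition is_heavy (B : {set point d}) (u j : nat) (o1 : O1) (sx : m1.-tuple bool)
    (o2 : O2) (nx : m2.-tuple bool) : bool :=
  let C := candidates B u o1 sx in
  #|C| < 2 ^ e.+1 * #|[set z in C | acc2 nx (sk2 j o2 z)]|.

Definition fine_good (B : {set point d}) (x : point d) (o : O1) : bool :=
  [forall p : 'I_L.+1 * point d, (p.2 \in B) ==> ~~ sketch_err sk1 acc1 p.1 o x p.2].

Definition coarse_good (B : {set point d}) (x : point d) (o : O1) (o2 : O2) : bool :=
  [forall p : 'I_L.+1 * 'I_L.+1,
    let C := candidates B p.1 o (sk1 p.1 o x) in
    2 ^ e.+1 * #|[set z in C | sketch_err sk2 acc2 p.2 o2 x z]| <= #|C|].

Definition good_seed (B : {set point d}) (x : point d) (o : O1 * O2) : bool :=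
  fine_good B x o.1 && coarse_good B x o.1 o.2.

Hypothesis err1 : forall i x z, i <= L ->
  2 ^ e1 * #|[set o | sketch_err sk1 acc1 i o x z]| <= #|O1|.
Hypothesis err2 : forall i x z, i <= L ->
  2 ^ e2 * #|[set o | sketch_err sk2 acc2 i o x z]| <= #|O2|.

Lemma few_fine_bad (B : {set point d}) (x : point d) :
  0 < #|B| <= n -> 128 * (L.+1 * n) <= 2 ^ e1 ->
  128 * #|[set o | ~~ fine_good B x o]| <= #|O1|.
Proof.
move=> /andP[B0 Bn] e1_big.
have e1_big' : 128 * (L.+1 * #|B|) <= 2 ^ e1.
  by apply: leq_trans e1_big; rewrite !leq_mul.
set bad := #|_|.
have le_bad : bad * 2 ^ e1 <= L.+1 * #|B| * #|O1|.
  apply: leq_trans (leq_mul (union_bound _) (leqnn _)) _.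
  rewrite big_distrl /= -(pair_bigA _ (fun (i : 'I_L.+1) z =>
    #|[set o | ~~ ((z \in B) ==> ~~ sketch_err sk1 acc1 i o x z)]| * 2 ^ e1)) /=.
  rewrite -mulnA -[L.+1 in leqRHS]card_ord -sum_nat_const; apply: leq_sum => i _.
  rewrite -sum_nat_const (bigID (mem B)) /= [X in _ + X]big1 ?addn0 => [|z /negbTE zB].
    apply: leq_sum => z zB; rewrite mulnC; apply: leq_trans (err1 x z (ltn_ord i)).
    rewrite leq_mul //; apply: subset_leq_card; apply/subsetP => o.
    by rewrite !inE zB /= negbK.
  rewrite (_ : [set _ | _] = set0) ?cards0 //.
  by apply/setP => o; rewrite !inE zB.
rewrite -(leq_pmul2r (_ : 0 < L.+1 * #|B|)) ?muln_gt0 ?B0 //.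
by rewrite mulnAC mulnC [leqRHS]mulnC; apply: leq_trans le_bad; rewrite leq_mul.
Qed.

(** [C] depends on [o1] only, so the errors in [C] can be averaged over [o2]: Markov's inequality
    bounds the chance that they are too many, and a union bound runs over the pairs of levels. *)
Lemma few_coarse_bad (B : {set point d}) (x : point d) (o1 : O1) :
  128 * (L.+1 * L.+1 * 2 ^ e.+1) <= 2 ^ e2 ->
  128 * #|[set o2 | ~~ coarse_good B x o1 o2]| <= #|O2|.
Proof.
move=> e2_big; set bad := #|_|.
have le_bad : bad * 2 ^ e2 <= L.+1 * L.+1 * 2 ^ e.+1 * #|O2|.
  apply: leq_trans (leq_mul (union_bound _) (leqnn _)) _.
  rewrite big_distrl -mulnA -[L.+1 * L.+1](_ : #|{: 'I_L.+1 * 'I_L.+1}| = _); last first.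
    by rewrite card_prod card_ord.
  rewrite -sum_nat_const; apply: leq_sum => -[u j] _ /=.
  set C := candidates _ _ _ _.
  pose Y o2 := #|[set z in C | sketch_err sk2 acc2 j o2 x z]|.
  rewrite (_ : [set _ | _] = [set o2 | #|C| < 2 ^ e.+1 * Y o2]); last first.
    by apply/setP => o2; rewrite !inE -ltnNge.
  have [C0|C_gt0] := posnP #|C|.
    rewrite (_ : [set _ | _] = set0) ?cards0 //.
    apply/setP => o2; rewrite !inE C0 (_ : Y o2 = 0) ?muln0 //.
    by apply/eqP; rewrite -leqn0 -C0; apply: subset_leq_card; apply/subsetP => z; rewrite !inE => /andP[].
  have sumY : 2 ^ e2 * \sum_o2 Y o2 <= #|C| * #|O2|.
    rewrite (eq_bigr (fun o2 => \sum_(z in C) (sketch_err sk2 acc2 j o2 x z : nat))); last first.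
      move=> o2 _; rewrite /Y -sum_bool_card [RHS]big_mkcond.
      by apply: eq_bigr => z _; case: (z \in C).
    rewrite exchange_big big_distrr /= -sum_nat_const; apply: leq_sum => z _.
    by rewrite sum_bool_card; apply: err2; rewrite -ltnS.
  have markov : #|[set o2 | #|C| < 2 ^ e.+1 * Y o2]| * #|C| <= 2 ^ e.+1 * \sum_o2 Y o2.
    rewrite -sum_nat_const big_distrr /= [leqRHS](bigID (fun o2 => #|C| < 2 ^ e.+1 * Y o2)) /=.
    apply: leq_trans (leq_addr _ _).
    rewrite [X in X <= _](eq_bigl (fun o2 => #|C| < 2 ^ e.+1 * Y o2)) => [|o2]; last by rewrite inE.
    by apply: leq_sum => o2 /ltnW.
  rewrite -(leq_pmul2r C_gt0) mulnAC; apply: leq_trans (leq_mul markov (leqnn _)) _.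
  by rewrite -!mulnA leq_mul // mulnC [leqRHS]mulnC.
have big0 : 0 < L.+1 * L.+1 * 2 ^ e.+1 by rewrite !muln_gt0 expn_gt0.
rewrite -(leq_pmul2r big0).
by rewrite mulnAC mulnC [leqRHS]mulnC; apply: leq_trans le_bad; rewrite leq_mul.
Qed.

(** The fine and the coarse part contribute [1 / 128] each; the sampling of seeds requires
    [1 / 64]. *)
Lemma few_bad_seeds (B : {set point d}) (x : point d) :
  0 < #|B| <= n -> 128 * (L.+1 * n) <= 2 ^ e1 ->
  128 * (L.+1 * L.+1 * 2 ^ e.+1) <= 2 ^ e2 ->
  64 * #|[set o | ~~ good_seed B x o]| <= #|{: O1 * O2}|.
Proof.
move=> Bn e1_big e2_big; have h1 := few_fine_bad x Bn e1_big.
have h2 := few_coarse_bad B x _ e2_big.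
have split_bad : #|[set o | ~~ good_seed B x o]| <=
    #|[set o | ~~ fine_good B x o]| * #|O2| +
    \sum_o1 #|[set o2 | ~~ coarse_good B x o1 o2]|.
  rewrite -!sum_bool_card big_distrl /= -big_split /=.
  rewrite -(pair_bigA _ (fun o1 o2 => ~~ good_seed B x (o1, o2) : nat)) /=.
  apply: leq_sum => o1 _; rewrite -sum_bool_card -[#|O2|]sum1_card big_distrr -big_split /=.
  apply: leq_sum => o2 _; rewrite /good_seed /=.
  by case: fine_good; case: coarse_good.
apply: leq_trans (leq_mul (leqnn _) split_bad) _.
rewrite -(leq_pmul2l (isT : 0 < 2)) mulnA -[2 * 64]/128 mulnDr card_prod mul2n -addnn.
apply: leq_add; first by rewrite mulnA leq_mul.
rewrite big_distrr /= -[#|O1|]sum1_card big_distrl /=; apply: leq_sum => o1 _.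
by rewrite mul1n.
Qed.

Hypothesis near_mono : forall i x z, near i x z -> near i.+1 x z.

Section GoodSearch.

Variables (B : {set point d}) (x : point d) (o1 : O1) (o2 : O2).
Hypothesis good : good_seed B x (o1, o2).

Local Notation C u := (candidates B u o1 (sk1 u o1 x)).
Local Notation heavy u j := (is_heavy B u j o1 (sk1 u o1 x) o2 (sk2 j o2 x)).

Let near_le i j z : i <= j -> near i x z -> near j x z.
Proof.
by move=> /subnK <-; elim: (j - i) => // k IH /IH; rewrite addSn; apply: near_mono.
Qed.

Lemma near_candidate u z : 0 < u <= L -> z \in B -> near u x z -> z \in C u.
Proof.
move=> /andP[u0 uL] zB nz; rewrite /candidates gtn_eqF //.
rewrite inE zB; have /andP[/forallP fg _] := good.
have := fg (Ordinal (uL : u < L.+1), z); rewrite /= zB /sketch_err nz /=.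
by rewrite negb_or negbK => /andP[].
Qed.

Lemma candidate_near u z : u <= L -> z \in C u -> (z \in B) && near u.+1 x z.
Proof.
rewrite /candidates; case: eqP => [_|_] uL; rewrite ?inE // => /andP[zB az].
have /andP[/forallP fg _] := good.
have := fg (Ordinal (uL : u < L.+1), z); rewrite /= zB /sketch_err az /=.
by rewrite negb_or !andbT negbK => /andP[].
Qed.

Lemma candidates_mono u u' : u <= u' <= L -> #|C u| <= #|C u'|.
Proof.
move=> /andP[]; rewrite leq_eqVlt => /predU1P[-> //|lt_u uL].
apply: subset_leq_card; apply/subsetP => z /(candidate_near (ltnW (leq_trans lt_u uL))).
by case/andP=> zB nz; apply: near_candidate => //; [lia | apply: near_le nz].
Qed.

Let coarse_errors u j : u <= L -> j <= L ->
  2 ^ e.+1 * #|[set z in C u | sketch_err sk2 acc2 j o2 x z]| <= #|C u|.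
Proof.
move=> uL jL; have /andP[_ /forallP cg] := good.
exact: (cg (Ordinal (uL : u < L.+1), Ordinal (jL : j < L.+1))).
Qed.

(** More points are accepted than misclassified, so some accepted point really is near at [j.+1]. *)
Lemma heavy_candidate u j : 0 < j < u -> u <= L -> heavy u j -> C j.+1 != set0.
Proof.
move=> /andP[j0 ju] uL hv; have jL : j <= L by lia.
have lt_card : #|[set z in C u | sketch_err sk2 acc2 j o2 x z]| <
    #|[set z in C u | acc2 (sk2 j o2 x) (sk2 j o2 z)]|.
  rewrite -(ltn_pmul2l (_ : 0 < 2 ^ e.+1)) ?expn_gt0 //.
  exact: leq_ltn_trans (coarse_errors uL jL) hv.
have /subsetPn[z] : ~~ ([set z in C u | acc2 (sk2 j o2 x) (sk2 j o2 z)]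
    \subset [set z in C u | sketch_err sk2 acc2 j o2 x z]).
  by apply: contraL lt_card => /subset_leq_card; rewrite -leqNgt.
rewrite inE => /andP[zC az]; rewrite inE zC /sketch_err az /= negb_or andbT negbK => /andP[_ nz].
have /andP[zB _] := candidate_near uL zC.
by apply/set0Pn; exists z; apply: near_candidate => //; lia.
Qed.

(** Points of [C j.-1] are near at [j], hence accepted by the coarse sketch or misclassified; each
    kind is at most a fraction [1 / 2 ^ e.+1] of [C u]. *)
Lemma light_candidates u j :
  0 < j <= u -> u <= L -> ~~ heavy u j -> #|C j.-1| * 2 ^ e <= #|C u|.
Proof.
move=> /andP[j0 ju] uL; rewrite -leqNgt => light; have jL : j <= L by lia.
have := coarse_errors uL jL; set E := [set z in C u | sketch_err _ _ _ _ _ _] => err_small.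
set A := [set z in C u | _] in light.
have sub : C j.-1 \subset A :|: E.
  apply/subsetP => z zC; have jL' : j.-1 <= L by lia.
  have /andP[zB nz] := candidate_near jL' zC; rewrite prednK // in nz.
  have zCu : z \in C u by apply: near_candidate; [lia | by [] | exact: near_le nz].
  by rewrite !inE zCu /= /sketch_err nz /=; case: acc2; rewrite ?orbT.
have := leq_trans (subset_leq_card sub) (leq_card_setU _ _) => le_C.
rewrite -(leq_pmul2l (isT : 0 < 2)) mulnCA -expnS.
apply: leq_trans (leq_mul le_C (leqnn _)) _.
by rewrite mulnC mulnDr mul2n -addnn leq_add.
Qed.

End GoodSearch.

End GoodSeeds.

(** * The table, its addresses and the probing algorithm *)

Lemma ffact_le_expn (m n : nat) : m ^_ n <= m ^ n.
Proof.
elim: n => [|n IH]; first by rewrite ffactn0.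
by rewrite ffactnSr expnSr leq_mul // leq_subr.
Qed.

(** The exponent, rather than the count itself, is what the number of sampled seeds must exceed. *)
Lemma card_instances (d n : nat) :
  #|{: point d * {B : {set point d} | #|B| == n}}| <= 2 ^ (d * n.+1).
Proof.
rewrite card_prod card_tuple card_bool mulnS expnD leq_mul //.
rewrite card_sig -[X in X <= _]cardsE card_draws card_tuple card_bool expnM.
apply: leq_trans (ffact_le_expn _ _); rewrite -bin_ffact.
by rewrite leq_pmulr // fact_gt0.
Qed.

Lemma flatten_mkseq (T : Type) (q g : nat) (H : nat -> T) :
  flatten (mkseq (fun c => mkseq (fun i => H (c * g + i)) g) q) = mkseq H (q * g).
Proof.
elim: q => [|q IH]; first by rewrite mul0n.
rewrite mulSnr -[q.+1]addn1 /mkseq !iotaD !map_cat flatten_cat -/(mkseq _ q) IH.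
by rewrite /= cats0 !add0n -[in iota (q * g)](addn0 (q * g)) iotaDl -map_comp.
Qed.

Lemma map_enum_ord (T : Type) (m : nat) (H : nat -> T) :
  [seq H (i : 'I_m) | i <- enum 'I_m] = mkseq H m.
Proof. by rewrite /mkseq -val_enum_ord -map_comp. Qed.

Section Scheme.

Variables (d n L : nat) (near : nat -> rel (point d)).
Variables (m1 m2 e : nat) (O1 O2 : finType).
Variables (sk1 : sketch_family d m1 O1) (acc1 : rel (m1.-tuple bool)).
Variables (sk2 : sketch_family d m2 O2) (acc2 : rel (m2.-tuple bool)).
Variables (coin q g k : nat).

Local Notation coins_t := (coin.-tuple bool).

(** The [q * g] grid levels are split into [q] chunks of [g], the number of coarse sketches held by
    one address. The address also names the seed, so the table is deterministic and serves all
    coins. *)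
Definition address : finType :=
  (coins_t * 'I_L.+1 * 'I_L.+1 * 'I_q * m1.-tuple bool * g.-tuple (m2.-tuple bool))%type.

Definition content : finType := option (point d * g.-tuple bool)%type.

Lemma card_address :
  #|address| = 2 ^ coin * L.+1 * L.+1 * q * 2 ^ m1 * (2 ^ m2) ^ g.
Proof. by rewrite /address !card_prod !card_tuple !card_bool !card_ord. Qed.

Lemma card_content : #|content| <= 2 ^ (d + g).+1.
Proof.
rewrite /content card_option card_prod !card_tuple card_bool -expnD expnS mul2n -addnn.
by rewrite -addn1 leq_add // expn_gt0.
Qed.

Variables (near_mono : forall i x z, near i x z -> near i.+1 x z)
  (near_top : forall x z, near L x z).
Variables (Lam f a s : nat).
Hypotheses (n_gt0 : 0 < n) (q_gt0 : 0 < q).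
Hypotheses (L_def : L = 2 ^ Lam) (f_gt0 : 0 < f) (tau_ge : 2 ^ f <= q * g).
Hypotheses (n_lt : n < (2 ^ e) ^ s) (fa_ge : Lam <= f * a) (k_ge : a.+1 + s <= k).

Variable F : {ffun coins_t -> O1 * O2}.

Definition pick_candidate (C : {set point d}) : point d :=
  odflt (nseq_tuple d false) [pick z in C].

Definition cell (B : {set point d}) (a : address) : content :=
  let: (r, lo, hi, c, sx, nx) := a in
  let C := candidates sk1 acc1 B hi (F r).1 sx in
  if C == set0 then None
  else Some (pick_candidate C,
    [tuple is_heavy e sk1 acc1 sk2 acc2 B hi (grid (q * g) lo hi (c * g + i))
             (F r).1 sx (F r).2 (tnth nx i) | i < g]).

Definition cell_address (r : coins_t) (x : point d) (lo hi : nat) (c : 'I_q) : address :=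
  (r, inord lo, inord hi, c, sk1 hi (F r).1 x,
   [tuple sk2 (grid (q * g) lo hi (c * g + i)) (F r).2 x | i < g]).

(** The chunks share [hi] and the fine sketch, so all their cells agree on the witness, or are all
    [None]; the first one decides. *)
Definition gather (cs : seq content) : option (point d * seq bool) :=
  if head None cs is Some (z, _)
  then Some (z, flatten [seq (if c is Some (_, b) then val b else [::]) | c <- cs])
  else None.

Section Answer.

Variables (B : {set point d}) (x : point d) (r : coins_t).

Local Notation C u := (candidates sk1 acc1 B u (F r).1 (sk1 u (F r).1 x)).

Definition level_answer (lo hi : nat) : option (point d * seq bool) :=
  answer (fun u => C u) (fun u => pick_candidate (C u))
    (fun u j => is_heavy e sk1 acc1 sk2 acc2 B u j (F r).1 (sk1 u (F r).1 x)
                  (F r).2 (sk2 j (F r).2 x))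
    (q * g) lo hi.

Lemma gather_cells (lo hi : nat) : 0 < q -> lo <= L -> hi <= L ->
  gather [seq cell B (cell_address r x lo hi c) | c <- enum 'I_q] = level_answer lo hi.
Proof.
move=> q0 loL hiL; rewrite /level_answer /answer.
pose H i := is_heavy e sk1 acc1 sk2 acc2 B hi (grid (q * g) lo hi i) (F r).1
  (sk1 hi (F r).1 x) (F r).2 (sk2 (grid (q * g) lo hi i) (F r).2 x).
have cellE (c : 'I_q) : cell B (cell_address r x lo hi c) =
    if C hi == set0 then None
    else Some (pick_candidate (C hi), [tuple H (c * g + i) | i < g]).
  rewrite /cell /cell_address !inordK //.
  by case: eqP => // _; congr (Some (_, _)); apply: eq_from_tnth => i; rewrite !tnth_mktuple.
rewrite (eq_map cellE) /gather.
have head_enum (T : Type) (t0 : T) (h : 'I_q -> T) :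
    head t0 [seq h c | c <- enum 'I_q] = h (Ordinal q0).
  rewrite -nth0 (nth_map (Ordinal q0)) ?size_enum_ord //.
  by congr h; apply: val_inj; rewrite /= nth_enum_ord.
rewrite head_enum; case: eqP => // _; rewrite -map_comp; congr (Some (_, _)).
rewrite -flatten_mkseq -map_enum_ord; congr flatten; apply: eq_map => c /=.
exact: map_enum_ord.
Qed.

Definition read_step (st : search_state (point d)) (cs : seq content) :
    search_state (point d) :=
  search_step (q * g) st (gather (take q cs)) (gather (drop q cs)).

Definition queries (x : point d) (st : search_state (point d)) : (q + q).-tuple address :=
  let: (l, v, u, _) := st in
  cat_tuple [tuple cell_address r x l v c | c < q] [tuple cell_address r x v u c | c < q].

Definition start : search_state (point d) := (0, 0, L, nseq_tuple d false).

Local Notation ideal := (ideal_step (fun u => C u) (fun u => pick_candidate (C u))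
    (fun u j => is_heavy e sk1 acc1 sk2 acc2 B u j (F r).1 (sk1 u (F r).1 x)
                  (F r).2 (sk2 j (F r).2 x)) (q * g)).

(** Holds for every seed; the range of the levels is carried along because [inord] is faithful only
    up to [L]. *)
Lemma iter_read_step (m : nat) :
  iter m (fun st => read_step st [seq cell B b | b <- queries x st]) start =
  iter m ideal start.
Proof.
pose ranged (st : search_state (point d)) := let: (l, v, u, _) := st in [&& l <= L, v <= L & u <= L].
suff H : iter m (fun st => read_step st [seq cell B b | b <- queries x st]) start =
    iter m ideal start /\ ranged (iter m ideal start) by case: H.
elim: m => [|m [IH rg]] /=; first by rewrite leqnn.
rewrite IH; move: (iter m ideal start) rg => [[[l v] u] z] /and3P[lL vL uL].
have -> : read_step (l, v, u, z) [seq cell B b | b <- queries x (l, v, u, z)] =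
    ideal (l, v, u, z).
  rewrite /read_step (_ : queries x _ = [seq cell_address r x l v c | c <- enum 'I_q]
    ++ [seq cell_address r x v u c | c <- enum 'I_q] :> seq address); last first.
    by [].
  have size_cells lo hi : size [seq cell B b |
      b <- [seq cell_address r x lo hi c | c <- enum 'I_q]] = q.
    by rewrite size_map size_map; exact: size_enum_ord.
  rewrite map_cat take_size_cat ?drop_size_cat //.
  have gatherE lo hi : lo <= L -> hi <= L -> gather [seq cell B b |
      b <- [seq cell_address r x lo hi c | c <- enum 'I_q]] = level_answer lo hi.
    move=> loL hiL; rewrite -(gather_cells q_gt0 loL hiL); congr gather.
    exact/esym/map_comp.
  by rewrite !gatherE.
split=> //; rewrite /ideal_step /search_step.
case: answer => [[z' hv]|].
  have [] := narrow_le (q * g) l v hv; case: narrow => v' u' /=; lia.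
case: answer => [[z' hv]|]; last by rewrite /= lL vL.
have [] := narrow_le (q * g) v u hv; case: narrow => v' u' /=; lia.
Qed.

(** By [near_top] the top level is nonempty and the search applies. Membership in level [u] puts [z]
    within radius [u.+1], and emptiness of level [l > 0] excludes all points near at [l]. *)
Lemma search_result : good_seed L near e sk1 acc1 sk2 acc2 B x (F r) ->
  0 < #|B| <= n ->
  exists l u, let z := (iter k ideal start).2 in
  [/\ l <= u <= L, u <= l + 5, z \in B, near u.+1 x z &
      l = 0 \/ forall y, y \in B -> ~~ near l x y].
Proof.
move=> good /andP[B0 Bn]; have good' := good; rewrite [F r]surjective_pairing in good'.
have L0 : 0 < L by rewrite L_def expn_gt0.
have candL z : z \in B -> z \in C L.
  by move=> zB; apply: (near_candidate good') => //; rewrite L0 leqnn.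
have [l [u [Cl zu luL gap]]] : bracketed (fun u => C u) L 5 (iter k ideal start).2.
  apply: (@search_correct _ _ _ _ _ L e n _ _ _ _ _ Lam f L_def f_gt0 tau_ge a s) => //.
  - move=> u /set0Pn[z zC]; rewrite /pick_candidate; case: pickP => //= none.
    by have := none z; rewrite zC.
  - by move=> u u'; apply: (candidates_mono near_mono good').
  - by move=> u j; apply: (heavy_candidate good').
  - by move=> u j; apply: (light_candidates near_mono good').
  - have /card_gt0P[z zB] := B0.
    by apply/set0Pn; exists z; exact: candL.
  - apply: leq_trans Bn; apply: subset_leq_card; apply/subsetP => z zC.
    by have /andP[] := candidate_near good' (leqnn L) zC.
have /andP[lu uL] := luL; have /andP[zB nz] := candidate_near good' uL zu.
exists l, u; split=> //; case: (posnP l) => [->|l0]; [by left|right=> y yB].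
apply/negP => ny; have : y \in C l.
  by apply: (near_candidate good') => //; rewrite l0 (leq_trans lu).
by rewrite Cl inE.
Qed.

End Answer.

Hypothesis F_good : forall p : point d * {B : {set point d} | #|B| == n},
  3 * #|[set r | ~~ good_seed L near e sk1 acc1 sk2 acc2 (val p.2) p.1 (F r)]|
  <= #|{: coins_t}|.

Variables (w : nat) (enc : content -> word w) (dec : word w -> content).
Hypothesis encK : cancel enc dec.

Definition anns_scheme : randomized_scheme (point d) (database d n) (point d) k #|address| w :=
  RandomizedScheme (fun B i => enc (cell (val B) (enum_val i)))
    (fun r => machine k start
       (fun x st => map_tuple enum_rank (queries r x st))
       (fun st ws => read_step st (map dec ws)) (fun st => st.2)).

Lemma run_anns_scheme (B : database d n) (x : point d) (r : coins_t) :
  run (algo anns_scheme r) (preprocess anns_scheme B) x =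
  (iter k (fun st => read_step st [seq cell (val B) b | b <- queries r x st]) start).2.
Proof.
rewrite run_machine; last by rewrite addn_gt0 q_gt0.
congr (_.2); apply: eq_iter => st /=; congr read_step.
by rewrite -!map_comp; apply: eq_map => b /=; rewrite encK enum_rankK.
Qed.

Lemma total_probes_anns_scheme : total_probes anns_scheme = k * (q + q).
Proof. by rewrite /total_probes sum_nat_const card_ord. Qed.

Lemma anns_scheme_solves (R : realType)
    (correct : point d -> database d n -> point d -> bool) :
  (forall x (B : database d n) z l u, l <= u <= L -> u <= l + 5 -> z \in val B ->
     near u.+1 x z -> l = 0 \/ (forall y, y \in val B -> ~~ near l x y) ->
     correct x B z) ->
  solves R anns_scheme correct.
Proof.
move=> correctP x B; rewrite /success_prob.
have few_bad := F_good (x, B).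
set good := [set r | correct x B _].
have bad_sub : ~: good \subset
    [set r | ~~ good_seed L near e sk1 acc1 sk2 acc2 (val B) x (F r)].
  apply/subsetP => r; rewrite !inE; apply: contra => gs.
  have Bn : 0 < #|val B| <= n by rewrite (eqP (valP B)) n_gt0 leqnn.
  rewrite run_anns_scheme iter_read_step.
  have [l [u [lu gap zB nz nl]]] := search_result gs Bn.
  exact: (correctP x B _ l u).
have le3 : 2 * #|{: coins_t}| <= 3 * #|good|.
  have := leq_trans (leq_mul (leqnn 3) (subset_leq_card bad_sub)) few_bad.
  by rewrite cardsCs setCK -[#|{: coins_t}|](cardsC good) /=; lia.
have tot0 : (0 < #|{: coins_t}|%:R :> R)%R by rewrite ltr0n card_tuple card_bool expn_gt0.
by rewrite ler_pdivlMr // mulrAC ler_pdivrMr // -!natrM ler_nat [leqRHS]mulnC.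
Qed.

End Scheme.

Lemma good_family_exists (d n L e coin : nat) (near : nat -> rel (point d))
    (m1 m2 e1 e2 : nat) (O1 O2 : finType)
    (sk1 : sketch_family d m1 O1) (acc1 : rel (m1.-tuple bool))
    (sk2 : sketch_family d m2 O2) (acc2 : rel (m2.-tuple bool)) :
  0 < n -> 0 < #|O1| -> 0 < #|O2| ->
  (forall i x z, i <= L -> 2 ^ e1 * #|[set o | sketch_err near sk1 acc1 i o x z]| <= #|O1|) ->
  (forall i x z, i <= L -> 2 ^ e2 * #|[set o | sketch_err near sk2 acc2 i o x z]| <= #|O2|) ->
  128 * (L.+1 * n) <= 2 ^ e1 -> 128 * (L.+1 * L.+1 * 2 ^ e.+1) <= 2 ^ e2 ->
  d * n.+1 < 2 ^ coin ->
  exists F : {ffun coin.-tuple bool -> O1 * O2},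
    forall p : point d * {B : {set point d} | #|B| == n},
    3 * #|[set r | ~~ good_seed L near e sk1 acc1 sk2 acc2 (val p.2) p.1 (F r)]|
    <= #|{: coin.-tuple bool}|.
Proof.
move=> n0 O10 O20 err1 err2 e1_big e2_big coin_big.
apply: (few_bad_family (bad := fun (p : point d * {B : {set point d} | #|B| == n}) o =>
  ~~ good_seed L near e sk1 acc1 sk2 acc2 (val p.2) p.1 o)).
- by rewrite card_prod muln_gt0 O10.
- move=> p; apply: (few_bad_seeds err1 err2 _ _ e1_big e2_big).
  by rewrite (eqP (valP p.2)) n0 leqnn.
- apply: leq_ltn_trans (card_instances d n) _.
  by rewrite card_tuple card_bool ltn_exp2l.
Qed.

(** * Choice of the parameters *)

Section Choices.

Variables (base_log kappa n d k : nat).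
Hypotheses (base_log_ge7 : 7 <= base_log) (d_gt0 : 0 < d) (d_lt : d < n) (k_big : 6 <= k).

Local Notation lgn := (trunc_log 2 n).
Local Notation lgd := (trunc_log 2 d).

Definition loglog : nat := up_log 2 lgd.+1.
Definition levels_log : nat := base_log + loglog.
(* With [Lam + 1] rounds of each kind a constant fan-out already suffices; the cap keeps
   [phases * Lam = O(log n)], hence the addresses short, when [k] is large. *)
Definition phases : nat := minn k./2 levels_log.+1.
Definition shrinks : nat := phases.-1.
Definition fan_log : nat := (levels_log %/ shrinks).+1.
Definition width : nat := (2 ^ fan_log %/ phases).+1.
Definition drop_log : nat := (lgn %/ phases).+1.

Lemma lgn_gt0 : 0 < lgn.
Proof. by rewrite trunc_log_gt0; exact: leq_ltn_trans d_gt0 d_lt. Qed.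

Lemma lgd_le_lgn : lgd <= lgn.
Proof. exact/leq_trunc_log/ltnW. Qed.

Lemma loglog_exp : 0 < lgd -> 2 ^ loglog <= 2 * lgd.
Proof.
move=> lgd0; have lt1 : 1 < lgd.+1 by [].
have := up_log_gtn (isT : 1 < 2) lt1; rewrite -/loglog ltnS.
have : 0 < loglog by rewrite up_log_gt0.
by case: loglog => // p _ /=; rewrite expnS leq_pmul2l.
Qed.

Lemma loglog_le : loglog <= lgd.
Proof.
have [lgd0|lgd0] := posnP lgd; first by rewrite /loglog lgd0.
have := loglog_exp lgd0; case: loglog => // p.
by rewrite expnS leq_pmul2l // => /(leq_trans (ltn_expl p (isT : 1 < 2))).
Qed.

Lemma sqr_le_exp (p : nat) : p ^ 2 <= 2 * 2 ^ p.
Proof.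
elim/ltn_ind: p => -[|[|[|[|p]]]] IH //.
have := IH p.+3 (leqnn _); rewrite (expnS 2 p.+3); nia.
Qed.

(** Each of the [phases] coarse sketches in an address spends [O(levels_log)] bits on union bounds;
    this keeps their total in [O(log n)]. *)
Lemma loglog_sqr : loglog ^ 2 <= 4 * lgn.
Proof.
have [lgd0|lgd_gt0] := posnP lgd.
  by have := loglog_le; rewrite lgd0 leqn0 => /eqP ->.
apply: leq_trans (sqr_le_exp _) _; rewrite -[4]/(2 * 2) -mulnA leq_pmul2l //.
by apply: leq_trans (loglog_exp lgd_gt0) _; rewrite leq_pmul2l // lgd_le_lgn.
Qed.

Lemma phases_ge2 : 2 <= phases.
Proof. by clear d_gt0 d_lt; rewrite /phases /levels_log; lia. Qed.

Lemma phases_gt0 : 0 < phases.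
Proof. exact: leq_trans phases_ge2. Qed.

Lemma shrinks_gt0 : 0 < shrinks.
Proof. by rewrite /shrinks -subn1 subn_gt0 phases_ge2. Qed.

Lemma rounds_enough : shrinks.+1 + phases <= k.
Proof. by rewrite /shrinks; have := phases_ge2; clear; rewrite /phases; lia. Qed.

Lemma shrinks_enough : levels_log <= fan_log * shrinks.
Proof. by apply: ltnW; apply: ltn_ceil; exact: shrinks_gt0. Qed.

Lemma width_enough : 2 ^ fan_log <= width * phases.
Proof. by apply: ltnW; apply: ltn_ceil; exact: phases_gt0. Qed.

Lemma drops_enough : n < (2 ^ drop_log) ^ phases.
Proof.
rewrite -expnM; apply: leq_trans (trunc_log_ltn n (isT : 1 < 2)) _.
by rewrite leq_exp2l //; apply: ltn_ceil; exact: phases_gt0.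
Qed.

Lemma coins_enough : d * n.+1 < 2 ^ (2 * lgn.+1).
Proof.
rewrite [2 * _]mulnC expnM -mulnn.
apply: (@leq_trans (n.+1 * n.+1)); first by rewrite ltn_pmul2r // ltnS ltnW.
by rewrite leq_mul // trunc_log_ltn.
Qed.

Lemma fine_error_enough : 128 * ((2 ^ levels_log).+1 * n) <= 2 ^ (9 + levels_log + lgn).
Proof.
have n_le : n <= 2 * 2 ^ lgn by rewrite -expnS ltnW // trunc_log_ltn.
have X_le : (2 ^ levels_log).+1 <= 2 * 2 ^ levels_log.
  by rewrite mul2n -addnn -addn1 leq_add2l expn_gt0.
move: levels_log X_le => M X_le; rewrite !expnD -[2 ^ 9]/(128 * 4) -!mulnA leq_pmul2l //.
by apply: leq_trans (leq_mul X_le n_le) _; rewrite mulnACA.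
Qed.

Lemma coarse_error_enough :
  128 * ((2 ^ levels_log).+1 * (2 ^ levels_log).+1 * 2 ^ drop_log.+1)
  <= 2 ^ (10 + 2 * levels_log + drop_log).
Proof.
clear; move: levels_log drop_log => M D; rewrite [2 ^ D.+1]expnS mul2n -addnn !expnD.
have : 0 < 2 ^ M by rewrite expn_gt0.
move: (2 ^ M) (2 ^ D) => X Y X0.
rewrite -[2 ^ 10]/(128 * 8).
have h : X.+1 * X.+1 <= 4 * (X * X) by nia.
by have := leq_mul h (leqnn Y); lia.
Qed.

(** The factor of [kappa] pays for the sketches, the rest for the coins, the two levels and the
    chunk index. *)
Definition address_exponent : nat :=
  kappa * (4 * (base_log + 2) ^ 2 + 12 * (base_log + 2) + 40) + 3 * (base_log + 2) + 10.

Lemma levels_log_le : levels_log.+1 <= (base_log + 2) * lgn.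
Proof.
have := leq_trans loglog_le lgd_le_lgn; have := lgn_gt0; rewrite /levels_log.
move: loglog lgn => p l l0 pl; have := leq_mul (leqnn base_log) l0; lia.
Qed.

Lemma levels_log_sqr : levels_log.+1 ^ 2 <= (2 * (base_log + 2) ^ 2 + 8) * lgn.
Proof.
have := loglog_sqr; have := lgn_gt0; rewrite /levels_log.
move: loglog lgn => p l l0 pl; have := leq_mul (leqnn (2 * (base_log + 2) ^ 2)) l0.
by rewrite -!mulnn in pl *; nia.
Qed.

(** The coarse sketches fit since [drop_log * phases] is at most [lgn + phases] and
    [levels_log * phases] is at most [levels_log.+1 ^ 2]. *)
Lemma address_exponent_enough :
  2 * lgn.+1 + levels_log.+1 + levels_log.+1 + fan_log.+1
    + kappa * (9 + levels_log + lgn)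
    + kappa * (10 + 2 * levels_log + drop_log) * phases
  <= address_exponent * lgn.
Proof.
have l0 := lgn_gt0; have lin := levels_log_le; have sq := levels_log_sqr.
have h_le : phases <= levels_log.+1 by rewrite /phases geq_minr.
have f_le : fan_log <= levels_log.+1 by rewrite /fan_log ltnS leq_div.
have eh_le : drop_log * phases <= lgn + phases.
  by rewrite /drop_log mulSn addnC leq_add2r leq_trunc_div.
move: (levels_log.+1) (leqnSn levels_log) lin sq h_le f_le => M le_M lin sq h_le f_le.
rewrite /address_exponent.
have coarse : (10 + 2 * levels_log + drop_log) * phases <=
    (4 * (base_log + 2) ^ 2 + 11 * (base_log + 2) + 17) * lgn.
  have : levels_log * phases <= M ^ 2 by rewrite -mulnn leq_mul.
  have -> : (10 + 2 * levels_log + drop_log) * phases =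
      10 * phases + 2 * (levels_log * phases) + drop_log * phases by ring.
  move: (levels_log * phases) (drop_log * phases) (M ^ 2) ((base_log + 2) ^ 2) sq eh_le.
  by move=> X Y M2 K sq eh_le; lia.
have fine : 9 + levels_log + lgn <= ((base_log + 2) + 10) * lgn by lia.
have := leq_mul (leqnn kappa) coarse; have := leq_mul (leqnn kappa) fine.
by rewrite -[kappa * _ * phases]mulnA; lia.
Qed.

Lemma table_size_bound :
  2 ^ (2 * lgn.+1) * (2 ^ levels_log).+1 * (2 ^ levels_log).+1 * width
    * 2 ^ (kappa * (9 + levels_log + lgn))
    * (2 ^ (kappa * (10 + 2 * levels_log + drop_log))) ^ phases
  <= n ^ address_exponent.
Proof.
apply: (@leq_trans (2 ^ (address_exponent * lgn))); last first.
  rewrite mulnC expnM leq_exp2r; last by rewrite /address_exponent; lia.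
  by apply: trunc_logP; lia.
apply: (@leq_trans _ _ _ _ (leq_pexp2l (isT : 0 < 2) address_exponent_enough)).
have pow_S m : (2 ^ m).+1 <= 2 ^ m.+1.
  by rewrite expnS mul2n -addnn -addn1 leq_add2l expn_gt0.
have w_le : width <= 2 ^ fan_log.+1.
  by apply: leq_trans (pow_S _); rewrite /width ltnS leq_div.
move: phases drop_log width fan_log levels_log w_le => h D W f M w_le.
by rewrite -expnM !expnD !leq_mul.
Qed.

(** The cap makes [phases] at most [base_log + loglog + 1], and [loglog <= lgd < d]. *)
Lemma word_size_bound : (d + phases).+1 <= (base_log + 4) * d.
Proof.
have : lgd < d.
  by apply: leq_trans (ltn_expl lgd (isT : 1 < 2)) _; apply: trunc_logP.
have := loglog_le; clear base_log_ge7 k_big d_lt; rewrite /phases /levels_log; nia.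
Qed.

Lemma probes_bound : k * width <= 5 * k + 6 * 2 ^ (levels_log %/ k./2.-1).
Proof.
clear d_gt0 d_lt; rewrite /width /fan_log /shrinks /phases.
have [le_h|lt_h] := leqP k./2 levels_log.+1.
  rewrite expnS; set Y := 2 ^ _.
  have := leq_trunc_div (2 * Y) k./2; move: (_ %/ _) => Z.
  have : k <= 3 * k./2 by lia.
  by move: (k./2) => h; nia.
(* In the capped case [shrinks = levels_log], so [fan_log = 2] and [width <= 5]. *)
rewrite /= divnn; have -> /= : 0 < levels_log by rewrite /levels_log; lia.
have : 2 ^ 2 %/ levels_log.+1 <= 4 by apply: leq_div.
by move: (_ %/ _) (2 ^ _) => X Y; nia.
Qed.

End Choices.

Local Open Scope ring_scope.

(** * Tail bounds by exponential moments *)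

Lemma expR_le_quadratic (R : realType) (y : R) :
  `|y| <= 2^-1 -> expR y <= 1 + y + 2 * y ^+ 2.
Proof.
rewrite ler_norml => /andP[y_ge y_le].
have ge1 : 1 - y <= expR (- y) by apply: expR_ge1Dx.
have gt0 : 0 < 1 - y by lra.
rewrite -[y in expR y]opprK expRN; apply: (@le_trans _ _ (1 - y)^-1).
  by rewrite lef_pV2 ?posrE ?expR_gt0.
rewrite -[leLHS]mul1r ler_pdivrMr //.
have -> : (1 + y + 2 * y ^+ 2) * (1 - y) = 1 + y ^+ 2 * (1 - 2 * y) by ring.
by rewrite lerDl mulr_ge0 ?sqr_ge0 //; lra.
Qed.

Lemma moment_bound (R : realType) (O : finType) (m : nat) (wt : O -> R)
    (P : pred {ffun 'I_m -> O}) :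
  (forall o, 0 <= wt o) -> (forall w, P w -> 1 <= \prod_j wt (w j)) ->
  #|[set w | P w]|%:R <= (\sum_o wt o) ^+ m.
Proof.
move=> wt_ge0 P_ge1.
have -> : (\sum_o wt o) ^+ m = \sum_(w : {ffun 'I_m -> O}) \prod_j wt (w j).
  transitivity (\prod_(j < m) \sum_o wt o); first by rewrite prodr_const card_ord.
  by rewrite bigA_distr_bigA.
rewrite -sum_bool_card natr_sum; apply: ler_sum => w _.
have [Pw|_] := boolP (P w); [exact: P_ge1 | exact: prodr_ge0].
Qed.

(** Either sign of [l] is allowed, so one estimate serves both tails: the last hypothesis says that
    the density of [E] misses [theta] by [delta] on the side given by the sign. *)
Lemma tilted_sum_le (R : realType) (O : finType) (E : pred O) (theta delta l : R) :
  0 < delta <= 1 -> `|l| = delta / 4 ->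
  l * #|[set o | E o]|%:R <= (l * theta - delta ^+ 2 / 4) * #|O|%:R ->
  \sum_o expR (l * ((E o)%:R - theta)) <= expR (- (delta ^+ 2 / 8)) * #|O|%:R.
Proof.
move=> /andP[delta_gt0 delta_le1] l_abs lE.
set e := #|[set o | E o]|%:R in lE; set N := #|O|%:R in lE *.
have l2 : l ^+ 2 = delta ^+ 2 / 16 by rewrite -real_normK ?num_real // l_abs; field.
have eN : e <= N by rewrite ler_nat max_card.
have e0 : 0 <= e by rewrite ler0n.
have -> : \sum_o expR (l * ((E o)%:R - theta)) =
    expR (- (l * theta)) * (N + e * (expR l - 1)).
  rewrite (eq_bigr (fun o => expR (- (l * theta)) * (1 + (E o)%:R * (expR l - 1)))).
    rewrite -big_distrr big_split /= sumr_const -big_distrl /= -natr_sum.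
    by rewrite sum_bool_card.
  move=> o _; case: (E o); rewrite ?mul0r ?addr0 ?mul1r ?mulr1.
    by rewrite mulrBr mulr1 expRD addrC subrK mulrC.
  by rewrite sub0r mulrN.
have el : expR l - 1 <= l + 2 * l ^+ 2.
  by rewrite lerBlDl addrA; apply: expR_le_quadratic; rewrite l_abs; lra.
have step : N + e * (expR l - 1) <= N * expR (l * theta - delta ^+ 2 / 8).
  apply: (@le_trans _ _ (N * (1 + (l * theta - delta ^+ 2 / 8)))); last first.
    by rewrite ler_wpM2l ?ler0n // expR_ge1Dx.
  have := ler_wpM2l e0 el; rewrite l2 => h1.
  have h2 : e * delta ^+ 2 <= N * delta ^+ 2 by rewrite ler_wpM2r ?sqr_ge0.
  by lra.
have := ler_wpM2l (expR_ge0 (- (l * theta))) step.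
move=> /le_trans; apply; rewrite mulrCA -expRD.
by rewrite addrA addNr add0r mulrC.
Qed.

Section Tails.

Variables (R : realType) (O : finType) (E : pred O) (theta delta : R) (m : nat).
Hypothesis delta_bound : 0 < delta <= 1.

Let hits (w : {ffun 'I_m -> O}) : R := #|[set j | E (w j)]|%:R.

Let prod_tilt (l : R) (w : {ffun 'I_m -> O}) :
  \prod_j expR (l * ((E (w j))%:R - theta)) = expR (l * (hits w - theta * m%:R)).
Proof.
rewrite -expR_sum -mulr_sumr; congr (expR (_ * _)).
by rewrite sumrB -natr_sum sum_bool_card sumr_const card_ord mulr_natr.
Qed.

Lemma upper_tail :
  #|[set o | E o]|%:R <= (theta - delta) * #|O|%:R ->
  #|[set w | theta * m%:R < hits w]|%:R
    <= expR (- (delta ^+ 2 / 8)) ^+ m * (#|O| ^ m)%:R.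
Proof.
(* [delta / 4] minimises [2 * l ^ 2 - l * delta], the exponent per sample; the minimum is
   [- delta ^ 2 / 8]. *)
move=> hE; have /andP[d0 d1] := delta_bound; pose l := delta / 4.
have l0 : 0 < l by rewrite /l; lra.
rewrite natrX -exprMn; apply: (@le_trans _ _
  ((\sum_o expR (l * ((E o)%:R - theta))) ^+ m)).
  apply: moment_bound => [o|w lt_w]; first exact: expR_ge0.
  by rewrite prod_tilt leNgt expR_lt1 -leNgt mulr_ge0 ?subr_ge0 //; exact: ltW.
apply: lerXn2r; rewrite ?nnegrE ?mulr_ge0 ?expR_ge0 //.
  by apply: sumr_ge0 => o _; exact: expR_ge0.
apply: tilted_sum_le => //; first by rewrite gtr0_norm.
have := ler_wpM2l (ltW l0) hE; rewrite /l; lra.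
Qed.

Lemma lower_tail :
  (theta + delta) * #|O|%:R <= #|[set o | E o]|%:R ->
  #|[set w | hits w <= theta * m%:R]|%:R
    <= expR (- (delta ^+ 2 / 8)) ^+ m * (#|O| ^ m)%:R.
Proof.
move=> hE; have /andP[d0 d1] := delta_bound; pose l := - (delta / 4).
have l0 : 0 <= - l by rewrite /l; lra.
rewrite natrX -exprMn; apply: (@le_trans _ _
  ((\sum_o expR (l * ((E o)%:R - theta))) ^+ m)).
  apply: moment_bound => [o|w le_w]; first exact: expR_ge0.
  by rewrite prod_tilt leNgt expR_lt1 -leNgt -mulrNN mulr_ge0 // oppr_ge0 subr_le0.
apply: lerXn2r; rewrite ?nnegrE ?mulr_ge0 ?expR_ge0 //.
  by apply: sumr_ge0 => o _; exact: expR_ge0.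
apply: tilted_sum_le => //; first by rewrite normrN gtr0_norm //; lra.
have := ler_wpM2l l0 hE; rewrite /l; lra.
Qed.

End Tails.

(** * Random parities and the sketches made of them *)

(* Padding the [d] coordinates with [K * d] constant ones keeps the probability of
   hitting a differing coordinate below [1 / K.+1] at every scale. *)
Definition parity_seed (K d rmax : nat) : finType :=
  {ffun 'I_rmax -> 'I_K.+1 * 'I_d * bool}.

(** One seed of length [rmax] serves all levels, each using its first [r] samples. The bit [(o j).2]
    keeps a sample with probability [1 / 2]. *)
Definition parity_row (K d rmax r : nat) (o : parity_seed K d rmax) (x : point d) : bool :=
  \big[addb/false]_(j < rmax | (j < r)%N)
    [&& (o j).2, (o j).1.1 == ord0 & tnth x (o j).1.2].

Section Parity.

Variables (R : realType) (K d rmax r : nat) (x z : point d).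
Hypotheses (d_gt0 : (0 < d)%N) (le_r : (r <= rmax)%N).

Local Notation seed := (parity_seed K d rmax).
Local Notation u := ((hdist x z)%:R / (K.+1 * d)%:R : R).

Let coord_sum :
  \sum_(c : 'I_K.+1 * 'I_d * bool)
     (-1) ^+ [&& c.2, c.1.1 == ord0 & tnth x c.1.2 (+) tnth z c.1.2]
  = (2 * (K.+1 * d))%:R * (1 - u) :> R.
Proof.
rewrite -(pair_bigA _ (fun (p : 'I_K.+1 * 'I_d) (b : bool) =>
  (-1) ^+ [&& b, p.1 == ord0 & tnth x p.2 (+) tnth z p.2])) /=.
rewrite (eq_bigr (fun p : 'I_K.+1 * 'I_d => 2 -
    2 * ((p.1 == ord0) && (tnth x p.2 (+) tnth z p.2))%:R)); last first.
  by move=> p _; rewrite big_bool /=; case: (_ && _); rewrite /= ?expr1 ?expr0; ring.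
rewrite sumrB sumr_const card_prod !card_ord -mulr_sumr -natr_sum.
have -> : (\sum_(p : 'I_K.+1 * 'I_d)
    ((p.1 == ord0) && (tnth x p.2 (+) tnth z p.2) : nat) = hdist x z)%N.
  rewrite -(pair_bigA _ (fun (k : 'I_K.+1) (t : 'I_d) =>
    (k == ord0) && (tnth x t (+) tnth z t) : nat)) /=.
  rewrite big_ord_recl [X in (_ + X)%N]big1 ?addn0; last by move=> k _; rewrite big1.
  rewrite /hdist -sum_bool_card; apply: eq_bigr => t _ /=.
  by case: (tnth x t); case: (tnth z t).
have nz : (K.+1 * d)%:R != 0 :> R by rewrite pnatr_eq0; lia.
rewrite -[2 *+ (K.+1 * d)]mulr_natr [(2 * _)%:R]natrM; move: ((K.+1 * d)%:R : R) nz => N nz.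
by field.
Qed.

(** The sign of the difference of parities is a product of [r] independent signs of mean [1 - u], so
    its mean is [(1 - u) ^ r]. *)
Lemma parity_diff_card :
  #|[set o : seed | parity_row r o x (+) parity_row r o z]|%:R
  = #|seed|%:R * ((1 - (1 - u) ^+ r) / 2) :> R.
Proof.
set D := #|_|%:R.
pose y (c : 'I_K.+1 * 'I_d * bool) :=
  [&& c.2, c.1.1 == ord0 & tnth x c.1.2 (+) tnth z c.1.2].
have sign_row (o : seed) :
    (-1) ^+ (parity_row r o x (+) parity_row r o z) =
    \prod_(j < rmax) (if (j < r)%N then (-1) ^+ y (o j) else 1) :> R.
  rewrite -big_mkcond -big_split /=.
  rewrite (big_morph (fun b : bool => (-1) ^+ b : R) (id1 := 1) (op1 := *%R)) //.
    apply: eq_bigr => j _; rewrite /y; congr (_ ^+ nat_of_bool _).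
    by case: (o j).2; case: (_ == _) => //; rewrite addbb.
  by move=> b b'; rewrite signr_addb.
have sum_sign : \sum_(o : seed) (-1) ^+ (parity_row r o x (+) parity_row r o z) =
    #|seed|%:R * (1 - u) ^+ r :> R.
  rewrite (eq_bigr _ (fun o _ => sign_row o)).
  rewrite -(bigA_distr_bigA (fun (j : 'I_rmax) c => if (j < r)%N then (-1) ^+ y c else 1)).
  rewrite (eq_bigr (fun j : 'I_rmax =>
    (2 * (K.+1 * d))%:R * (if (j < r)%N then 1 - u else 1))); last first.
    move=> j _; case: ifP => _; first exact: coord_sum.
    by rewrite sumr_const !card_prod !card_ord card_bool mulr1 mulnC.
  rewrite big_split /= prodr_const card_ord -big_mkcond /=.
  rewrite (big_ord_narrow le_r) prodr_const card_ord.
  by rewrite card_ffun !card_prod !card_ord card_bool natrX mulnC.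
have : D = (#|seed|%:R - #|seed|%:R * (1 - u) ^+ r) / 2.
  rewrite -sum_sign /D -sum_bool_card natr_sum.
  rewrite -[#|seed|]sum1_card natr_sum -sumrB mulr_suml; apply: eq_bigr => o _.
  by case: (_ (+) _); rewrite /= ?expr1 ?expr0; field.
by move=> ->; field.
Qed.

End Parity.

(** With [r] about [K.+1 * d / rho], the product [r * u] is about [hdist x z / rho], and
    [(1 - u) ^ r] lies between [expR (- r * u / (1 - u))] and [expR (- r * u)]. *)
Lemma parity_row_gap (R : realType) (alpha : R) : 1 < alpha ->
  exists (K : nat) (p0 p1 : R), [/\ 0 <= p0, p0 < p1, p1 <= 1 &
  forall (d rmax r : nat) (rho : R) (x z : point d),
    (0 < d)%N -> (r <= rmax)%N -> 0 < rho ->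
    (K.+1 * d)%:R / rho <= r%:R <= (K.+1 * d)%:R / rho + 1 ->
  let diff := #|[set o : parity_seed K d rmax |
                   parity_row r o x (+) parity_row r o z]|%:R in
    ((hdist x z)%:R <= rho -> diff <= p0 * #|parity_seed K d rmax|%:R) /\
    (alpha * rho < (hdist x z)%:R -> p1 * #|parity_seed K d rmax|%:R <= diff)].
Proof.
move=> a1; pose beta : R := (1 + alpha) / 2.
have b1 : 1 < beta by rewrite /beta; lra.
(* [K] is so large that rounding [r] up and the factor [1 / (1 - u)] together cost at most
   [beta]. *)
pose K := Num.bound ((1 + beta) / (beta - 1)).
have K_big : (1 + beta) / (beta - 1) < K.+1%:R.
  apply: (@lt_trans _ _ K%:R); last by rewrite ltr_nat.
  by apply: archi_boundP; rewrite divr_ge0 //; lra.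
have e_small : (1 + K.+1%:R^-1) / (1 - K.+1%:R^-1) <= beta.
  have K0 : 0 < K.+1%:R :> R by rewrite ltr0n.
  have Kb : 1 + beta < K.+1%:R * (beta - 1) by rewrite -ltr_pdivrMr //; lra.
  have K1 : 1 < K.+1%:R :> R by nra.
  rewrite ler_pdivrMr; last by rewrite subr_gt0 invf_lt1.
  rewrite -(ler_pM2l K0).
  have -> : K.+1%:R * (1 + K.+1%:R^-1) = K.+1%:R + 1 :> R by field; rewrite lt0r_neq0.
  have -> : K.+1%:R * (beta * (1 - K.+1%:R^-1)) = beta * K.+1%:R - beta :> R.
    by field; rewrite lt0r_neq0.
  by lra.
exists K, ((1 - expR (- beta)) / 2), ((1 - expR (- alpha)) / 2).
have eb : expR (- alpha) < expR (- beta) by rewrite ltr_expR /beta; lra.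
have ea := expR_gt0 (- alpha).
have eb1 : expR (- beta) <= 1 by rewrite expR_le1; lra.
split; [lra|lra|lra|].
move=> d rmax r rho x z d0 rle rho0 /andP[r_ge r_le] diff.
have := parity_diff_card R K x z d0 rle; rewrite -/diff => ->.
set N := #|parity_seed K d rmax|%:R; set h := (hdist x z)%:R : R; set u := h / _.
have N0 : 0 <= N by rewrite ler0n.
have Kd0 : 0 < (K.+1 * d)%:R :> R by rewrite ltr0n; lia.
have h0 : 0 <= h by rewrite ler0n.
have hd : h <= d%:R by rewrite ler_nat /hdist; apply: leq_trans (max_card _) _; rewrite card_ord.
have K0 : 0 < K.+1%:R :> R by rewrite ltr0n.
have u0 : 0 <= u by rewrite divr_ge0 // ltW.
have K1 : 1 < K.+1%:R :> R.
  have : 1 + beta < K.+1%:R * (beta - 1) by rewrite -ltr_pdivrMr //; lra.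
  by nra.
have uK : u <= K.+1%:R^-1.
  by rewrite /u ler_pdivrMr // natrM mulKf ?lt0r_neq0.
have K1' : K.+1%:R^-1 < 1 :> R by rewrite invf_lt1.
have u1 : 0 < 1 - u by rewrite subr_gt0; exact: le_lt_trans K1'.
split=> hrho.
  rewrite [leRHS]mulrC ler_wpM2l // ler_pM2r ?invr_gt0 // lerD2l lerN2.
  have base : expR (- (u / (1 - u))) <= 1 - u.
    rewrite expRN -[leRHS]invrK lef_pV2 ?posrE ?invr_gt0 ?expR_gt0 //.
    apply: le_trans (expR_ge1Dx _).
    by rewrite le_eqVlt; apply/orP; left; apply/eqP; field; rewrite lt0r_neq0.
  apply: (@le_trans _ _ (expR (- (u / (1 - u))) ^+ r)); last first.
    by apply: lerXn2r; rewrite ?nnegrE ?expR_ge0 // ltW.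
  rewrite -expRM_natl ler_expR mulrN lerN2; apply: le_trans e_small.
  rewrite mulrA; apply: ler_pM.
  - by rewrite mulr_ge0.
  - by rewrite invr_ge0 ltW.
  - apply: (@le_trans _ _ (((K.+1 * d)%:R / rho + 1) * u)); first by rewrite ler_wpM2r.
    rewrite mulrDl mul1r lerD // /u mulrC mulrA divfK ?lt0r_neq0 //.
    by rewrite ler_pdivrMr ?mul1r.
  - by rewrite lef_pV2 ?posrE ?lerD2l ?lerN2 // subr_gt0.
rewrite [leLHS]mulrC ler_wpM2l // ler_pM2r ?invr_gt0 // lerD2l lerN2.
apply: (@le_trans _ _ (expR (- u) ^+ r)).
  by apply: lerXn2r; rewrite ?nnegrE ?expR_ge0 ?(ltW u1) // expR_ge1Dx.
rewrite -expRM_natl ler_expR mulrN lerN2.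
apply: (@le_trans _ _ ((K.+1 * d)%:R / rho * u)); last by rewrite ler_wpM2r.
by rewrite mulrC /u mulrA divfK ?lt0r_neq0 // ler_pdivlMr // ltW.
Qed.

(** The number of disagreeing parities is compared with a threshold midway between the two
    densities; [kappa] rows make the tail bound lose a factor 2, so [kappa * e] rows give error
    [1 / 2 ^ e]. *)
Lemma sketch_exists (R : realType) (alpha : R) : 1 < alpha ->
  exists kappa : nat, forall (d : nat) (rho : nat -> R) (L e : nat),
    (0 < d)%N -> (forall i, 0 < rho i) ->
  exists (O : finType) (sk : sketch_family d (kappa * e) O)
         (acc : rel ((kappa * e).-tuple bool)),
  (0 < #|O|)%N /\ forall i (x z : point d), (i <= L)%N ->
    (2 ^ e * #|[set o |
       ((hdist x z)%:R <= rho i)%R && ~~ acc (sk i o x) (sk i o z)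
       || (alpha * rho i < (hdist x z)%:R)%R && acc (sk i o x) (sk i o z)]|
     <= #|O|)%N.
Proof.
move=> a1; have [K [p0 [p1 [p0_ge0 p01 p1_le1 gap]]]] := parity_row_gap a1.
pose theta := (p0 + p1) / 2; pose delta := (p1 - p0) / 2.
have db : 0 < delta <= 1 by apply/andP; split; rewrite /delta; lra.
have d8 : 0 < delta ^+ 2 / 8 by rewrite divr_gt0 // exprn_gt0 //; case/andP: db.
pose kappa := Num.bound (delta ^+ 2 / 8)^-1.
have kappaP : expR (- (delta ^+ 2 / 8)) ^+ kappa <= 2^-1.
  rewrite -expRM_natl mulrN expRN lef_pV2 ?posrE ?expR_gt0 //.
  apply: le_trans (expR_ge1Dx _); rewrite -[leLHS]/(1 + 1) lerD2l.
  rewrite -ler_pdivrMr // mul1r; apply: ltW; apply: archi_boundP.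
  by rewrite invr_ge0 ltW.
exists kappa => d rho L e d0 rho0.
pose r i := (Num.trunc ((K.+1 * d)%:R / rho i)).+1.
pose rmax := (\max_(i < L.+1) r i)%N.
pose O : finType := {ffun 'I_(kappa * e) -> parity_seed K d rmax}.
pose sk : sketch_family d (kappa * e) O :=
  fun i o x => [tuple parity_row (r i) (o j) x | j < kappa * e].
exists O, sk, (fun a b => (hdist a b)%:R <= theta * (kappa * e)%:R); split.
  rewrite card_ffun expn_gt0 card_ffun expn_gt0 !card_prod !card_ord card_bool.
  by rewrite !muln_gt0 d0.
move=> i x z iL.
pose E (s : parity_seed K d rmax) := parity_row (r i) s x (+) parity_row (r i) s z.
have skE (o : O) : hdist (sk i o x) (sk i o z) = #|[set j | E (o j)]|.
  apply: eq_card => j; rewrite !inE !tnth_mktuple /E.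
  by case: (parity_row _ _ _); case: (parity_row _ _ _).
have y0 : 0 <= (K.+1 * d)%:R / rho i by rewrite divr_ge0 // ltW.
have /andP[tr_le tr_lt] := truncn_itv y0.
have r_itv : (K.+1 * d)%:R / rho i <= (r i)%:R <= (K.+1 * d)%:R / rho i + 1.
  by rewrite ltW //= -natr1 lerD2r.
have r_max : (r i <= rmax)%N.
  by rewrite /rmax -[i]/(nat_of_ord (Ordinal (iL : (i < L.+1)%N))); apply: leq_bigmax.
have [near far] := gap d rmax (r i) (rho i) x z d0 r_max (rho0 i) r_itv.
have finish (T : {set O}) :
    #|T|%:R <= expR (- (delta ^+ 2 / 8)) ^+ (kappa * e) * #|O|%:R ->
    (2 ^ e * #|T| <= #|O|)%N.
  move=> leT; rewrite -(ler_nat R) natrM natrX mulrC -ler_pdivlMr ?exprn_gt0 //.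
  apply: le_trans leT _; rewrite mulrC ler_wpM2l // exprM -exprVn.
  by apply: lerXn2r; rewrite ?nnegrE ?exprn_ge0 ?expR_ge0 ?invr_ge0.
apply: finish; rewrite [#|O|]card_ffun card_ord.
have [h_near|h_far] := leP (hdist x z)%:R (rho i).
  apply: le_trans (upper_tail (E := E) (theta := theta) _ db _); last first.
    have -> : theta - delta = p0 by rewrite /theta /delta; field.
    exact: near.
  rewrite ler_nat; apply: subset_leq_card; apply/subsetP => o; rewrite !inE skE.
  have -> : (alpha * rho i < (hdist x z)%:R) = false.
    by apply/negbTE; rewrite -leNgt; apply: le_trans h_near _; rewrite ler_peMl // ltW.
  by rewrite orbF -ltNge.
(* Between the two radii no error can occur. *)
have [h_mid|h_far'] := leP (hdist x z)%:R (alpha * rho i).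
  apply: (@le_trans _ _ 0); last by rewrite mulr_ge0 ?exprn_ge0 ?expR_ge0.
  by rewrite lern0 cards_eq0; apply/eqP/setP => o; rewrite !inE.
apply: le_trans (lower_tail (E := E) (theta := theta) _ db _); last first.
  have -> : theta + delta = p1 by rewrite /theta /delta; field.
  exact: far.
by rewrite ler_nat; apply: subset_leq_card; apply/subsetP => o; rewrite !inE skE.
Qed.

(** * From the number of rounds to the exponent [c / k] *)

Section Rounds.

Variables (R : realType) (c : R) (k : nat).
Hypotheses (hc : 2 < c) (hk : 5 * c ^+ 2 / (c - 2) < k%:R).

Lemma rounds_slack : 5 * c ^+ 2 < k%:R * (c - 2).
Proof. by rewrite -ltr_pdivrMr ?subr_gt0. Qed.

Lemma rounds_ge6 : (6 <= k)%N.
Proof.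
rewrite -(ler_nat R); have := rounds_slack; rewrite !expr2 => slack; have c2 := hc.
rewrite leNgt; apply/negP => k6.
have h1 : k%:R * (c - 2) <= 6 * (c - 2) by rewrite ler_wpM2r // ?subr_ge0; apply: ltW.
have h2 : 2 * c <= c * c by apply: ler_wpM2r; lra.
by lra.
Qed.

(** The slack exceeds [3 * c], which absorbs the rounding and the lost unit in [k./2.-1]; exponents
    [1 / k./2.-1] thus become [c / k]. *)
Lemma rounds_le : k%:R <= (k./2.-1)%:R * c.
Proof.
have k3 : k%:R <= (k./2.-1)%:R * 2 + 3 :> R.
  by rewrite -natrM -natrD ler_nat; have := rounds_ge6; lia.
have h1 := rounds_slack; have c2 := hc; have h2 : 2 * c <= c * c by apply: ler_wpM2r; lra.
rewrite expr2 in h1; have h3 : k%:R * c <= ((k./2.-1)%:R * 2 + 3) * c by apply: ler_wpM2r; lra.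
by lra.
Qed.

(** For [d > 1], [2 ^ loglog d] is at most [2 * k] times [log2 d / k], and [(2 * k) ^ (c / k)] is at
    most the constant [2 ^ (2 * c)]. *)
Lemma shrink_factor_bound (base_log d : nat) : (0 < d)%N ->
  (2 ^ (levels_log base_log d %/ k./2.-1))%:R
    <= 2 `^ (base_log%:R * c) * 2 `^ (2 * c) *
       (1 + (k%:R^-1 * log2 (d%:R : R)) `^ (c / k%:R)).
Proof.
move=> d0; have k6 := rounds_ge6; have kc := rounds_le.
have k0 : 0 < k%:R :> R by rewrite ltr0n; lia.
have c0 : 0 < c by apply: lt_trans hc.
have ck0 : 0 <= c / k%:R by rewrite divr_ge0 // ltW.
set T := _ `^ (c / k%:R); have T0 : 0 <= T by apply: powR_ge0.
have split_exp : (2 ^ (levels_log base_log d %/ k./2.-1))%:R <=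
    2 `^ (base_log%:R * c) * (2 ^ loglog d)%:R `^ (c / k%:R) :> R.
  rewrite natrX -powR_mulrn // natrX -[2 ^+ loglog d]powR_mulrn // -powRrM.
  rewrite -powRD ?pnatr_eq0 ?implybT //.
  apply: ler_powR; first by rewrite ler1n.
  have le_div : (levels_log base_log d %/ k./2.-1)%:R * (k./2.-1)%:R <= (levels_log base_log d)%:R :> R.
    by rewrite -natrM ler_nat leq_trunc_div.
  have -> : base_log%:R * c + (loglog d)%:R * (c / k%:R) =
      (base_log%:R * k%:R + (loglog d)%:R) * c / k%:R :> R by field; rewrite lt0r_neq0.
  rewrite ler_pdivlMr //; apply: (@le_trans _ _
    ((levels_log base_log d %/ k./2.-1)%:R * ((k./2.-1)%:R * c))); first by rewrite ler_wpM2l.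
  rewrite mulrA ler_wpM2r ?(ltW c0) //; apply: le_trans le_div _.
  by rewrite -natrM -natrD ler_nat /levels_log leq_add2r leq_pmulr //; lia.
apply: le_trans split_exp _; rewrite -mulrA ler_wpM2l ?powR_ge0 //.
have p1 : 1 <= 2 `^ (2 * c) :> R.
  by rewrite -[leLHS](powRr0 2) ler_powR ?ler1n // mulr_ge0 // ltW.
(* For [d = 1] the power of the logarithm vanishes, and the summand [1] is what remains. *)
have [lgd0|lgd0] := posnP (trunc_log 2 d).
  rewrite /loglog lgd0 up_log1 expn0 powR1.
  by apply: (@le_trans _ _ (1 * (1 + T))); [rewrite mul1r lerDl | rewrite ler_wpM2r // addr_ge0].
have ln2 : 0 < ln 2 :> R by rewrite ln_gt0 // ltr1n.
have lg_le : (trunc_log 2 d)%:R <= log2 (d%:R : R).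
  rewrite /log2 ler_pdivlMr // mulr_natl -lnXn ?ltr0n // ler_ln ?posrE ?exprn_gt0 ?ltr0n //.
  by rewrite -natrX ler_nat; apply: trunc_logP.
have k_exp : 2 * k%:R <= 2 `^ (2 * k%:R) :> R.
  rewrite -natrM powR_mulrn // -natrX ler_nat; apply: ltnW; exact: ltn_expl.
have base : (2 ^ loglog d)%:R <= (2 * k%:R) * (k%:R^-1 * log2 (d%:R : R)).
  have -> : 2 * k%:R * (k%:R^-1 * log2 (d%:R : R)) = 2 * log2 (d%:R : R).
    by field; rewrite lt0r_neq0.
  apply: (@le_trans _ _ (2 * (trunc_log 2 d)%:R)); last by rewrite ler_pM2l.
  by rewrite -natrM ler_nat; apply: loglog_exp.
have L0 : 0 <= k%:R^-1 * log2 (d%:R : R).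
  by rewrite mulr_ge0 ?invr_ge0 ?(ltW k0) // (le_trans _ lg_le).
apply: (@le_trans _ _ ((2 * k%:R * (k%:R^-1 * log2 (d%:R : R))) `^ (c / k%:R))).
  by apply: ge0_ler_powR; rewrite ?nnegrE // mulr_ge0 // mulr_ge0 // ltW.
rewrite powRM // ?mulr_ge0 ?(ltW k0) // -/T.
apply: (@le_trans _ _ (2 `^ (2 * c) * T)).
  rewrite ler_wpM2r //; apply: (@le_trans _ _ ((2 `^ (2 * k%:R)) `^ (c / k%:R))).
    by apply: ge0_ler_powR; rewrite ?nnegrE ?powR_ge0 // mulr_ge0 // ltW.
  by rewrite -powRrM; have -> : 2 * k%:R * (c / k%:R) = 2 * c by field; rewrite lt0r_neq0.
by rewrite ler_wpM2l ?powR_ge0 // lerDr.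
Qed.

End Rounds.

(** A word size linear in [d] leaves no bits here; the only point is the empty tuple, answered
    without probes. *)
Lemma zero_dim_scheme (R : realType) (gamma : R) (n k : nat) : (0 < n)%N ->
  exists S : randomized_scheme (point 0) (database 0 n) (point 0) k 0 0,
    solves R S (@anns_correct R gamma 0 n) /\ total_probes S = 0%N.
Proof.
move=> n0.
exists (@RandomizedScheme _ _ _ k 0 0 0 (fun=> 0%N) (fun _ (i : 'I_0) => [tuple])
  (fun=> @Algorithm _ _ k 0 0 (fun=> 0%N) (fun _ _ _ => [tuple]) (fun _ _ => [tuple]))).
split; last by rewrite /total_probes big1.
move=> x B; rewrite /success_prob.
rewrite (_ : [set r | _] = setT).
  by rewrite cardsT divff ?pnatr_eq0 ?card_tuple // ler_pdivrMr // mul1r ler_nat.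
apply/setP => r; rewrite !inE /anns_correct.
have /card_gt0P[z zB] : (0 < #|val B|)%N by rewrite (eqP (valP B)).
rewrite (tuple0 (run _ _ _)) -(tuple0 z) zB /=; apply/forall_inP => y _.
by rewrite /hdist !(eq_card0 (fun i : 'I_0 => _)) ?mulr0 // => -[].
Qed.

(** * Radii of the levels, and the approximation ratio *)

Section Radii.

Variables (R : realType) (alpha : R).
Hypothesis alpha_gt1 : 1 < alpha.

(* The shift by 7 makes the radius of level 6 smaller than 1, so that an answer
   whose bracket reaches level 0 is at distance 0. *)
Definition radius (i : nat) : R := alpha ^+ i / alpha ^+ 7.

Definition near_at (d : nat) (i : nat) : rel (point d) :=
  fun x z => (hdist x z)%:R <= radius i.

Lemma alpha_gt0 : 0 < alpha.
Proof. exact: lt_trans alpha_gt1. Qed.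

Lemma radius_gt0 (i : nat) : 0 < radius i.
Proof. by rewrite divr_gt0 // exprn_gt0 // alpha_gt0. Qed.

Lemma radiusD (i j : nat) : radius (i + j) = alpha ^+ j * radius i.
Proof. by rewrite /radius exprD mulrA (mulrC (alpha ^+ i)). Qed.

Lemma radiusS (i : nat) : radius i.+1 = alpha * radius i.
Proof. by rewrite -addn1 radiusD expr1. Qed.

Lemma radius_le (i j : nat) : (i <= j)%N -> radius i <= radius j.
Proof.
move=> le_ij; rewrite ler_pM2r ?invr_gt0 ?exprn_gt0 ?alpha_gt0 //.
by rewrite ler_weXn2l // ltW.
Qed.

Lemma radius6_lt1 : radius 6 < 1.
Proof.
by rewrite ltr_pdivrMr ?exprn_gt0 ?alpha_gt0 // mul1r ltr_eXn2l.
Qed.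

Lemma near_at_mono (d i : nat) (x z : point d) : near_at i x z -> near_at i.+1 x z.
Proof. by move=> /le_trans; apply; apply: radius_le. Qed.

(** The radius doubles within [K] levels, so [K * (trunc_log 2 d).+1] levels above the shift cover
    the whole cube. *)
Lemma near_at_top (K d : nat) (x z : point d) : 2 <= alpha ^+ K -> (0 < d)%N ->
  near_at (2 ^ levels_log (K + 7) d) x z.
Proof.
move=> aK d0; have hd : (hdist x z <= d)%N.
  by rewrite /hdist; apply: leq_trans (max_card _) _; rewrite card_ord.
have d_le : d%:R <= alpha ^+ (K * (trunc_log 2 d).+1).
  apply: (@le_trans _ _ (2 ^+ (trunc_log 2 d).+1)).
    by rewrite -natrX ler_nat; apply: ltnW; apply: trunc_log_ltn.
  by rewrite exprM lerXn2r ?nnegrE ?exprn_ge0 ?(ltW alpha_gt0).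
have L_ge : (K * (trunc_log 2 d).+1 + 7 <= 2 ^ levels_log (K + 7) d)%N.
  rewrite /levels_log expnD.
  apply: (@leq_trans ((K + 7).+1 * (trunc_log 2 d).+1)); first by nia.
  by rewrite leq_mul ?up_logP // ltn_expl.
apply: le_trans (radius_le L_ge); rewrite radiusD mulrC /radius divfK.
  by apply: le_trans d_le; rewrite ler_nat.
by rewrite expf_neq0 // lt0r_neq0 // alpha_gt0.
Qed.

(** The answer lies within radius [l + 6] and all of [B] beyond radius [l], a ratio [alpha ^ 6]. If
    [l = 0], the distance is below 1, hence 0. *)
Lemma bracket_correct (gamma : R) (d n : nat) (x z : point d) (B : database d n)
    (l u : nat) : alpha ^+ 6 <= gamma ->
  (u <= l + 5)%N -> z \in val B -> near_at u.+1 x z ->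
  l = 0%N \/ (forall y, y \in val B -> ~~ near_at l x y) ->
  anns_correct gamma x B z.
Proof.
move=> a6 gap zB nz far; rewrite /anns_correct zB; apply/forall_inP => y yB.
have g0 : 0 <= gamma by apply: le_trans a6; rewrite exprn_ge0 // ltW // alpha_gt0.
have nz6 : (hdist x z)%:R <= radius (l + 6).
  by apply: le_trans nz _; apply: radius_le; lia.
case: far => [l0|/(_ y yB)].
  rewrite l0 in nz6; have : (hdist x z)%:R < 1 :> R by apply: le_lt_trans nz6 radius6_lt1.
  by rewrite -[1]/(1%:R) ltr_nat ltnS leqn0 => /eqP ->; rewrite mulr_ge0.
rewrite -ltNge => /ltW far; apply: le_trans nz6 _; rewrite radiusD.
by apply: ler_pM => //; [rewrite exprn_ge0 // ltW // alpha_gt0 | exact/ltW/radius_gt0].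
Qed.

End Radii.

(** * Assembling the scheme *)

Lemma probes_arith (R : realFieldType) (x M T : R) : 1 <= x -> 1 <= M -> 0 <= T ->
  2 * (5 * x + 6 * (M * (1 + T))) <= (10 + 12 * M) * (x + T).
Proof.
move=> x1 M1 T0; have M0 : 0 <= M by lra.
by have := ler_wpM2l M0 x1; lra.
Qed.

Theorem theorem6 (R : realType) (gamma c : R) (hgamma : 1 < gamma) (hc : 2 < c) :
  exists (C : R) (a b : nat),
  forall (n d k : nat), (d < n)%N -> 5 * c ^+ 2 / (c - 2) < k%:R ->
  exists (s w : nat)
         (S : randomized_scheme (point d) (database d n) (point d) k s w),
    [/\ solves R S (@anns_correct R gamma d n),
        (total_probes S)%:R
          <= C * (k%:R + (k%:R^-1 * log2 (d%:R : R)) `^ (c / k%:R)),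
        (s <= n ^ a)%N
      & (w <= b * d)%N].
Proof.
have lng : 0 < ln gamma by apply: ln_gt0.
(* The sixth root of [gamma]: a bracket of gap 5 and the imprecision of one level cost six
   levels. *)
pose alpha := expR (ln gamma / 6).
have a1 : 1 < alpha by rewrite expR_gt1 divr_gt0.
have a6 : alpha ^+ 6 = gamma.
  rewrite /alpha -expRM_natl; have -> : 6 * (ln gamma / 6) = ln gamma by field.
  by rewrite lnK // posrE; apply: lt_trans hgamma.
pose K := Num.bound (6 / ln gamma).
have aK : 2 <= alpha ^+ K.
  rewrite /alpha -expRM_natl; apply: le_trans (expR_ge1Dx _).
  rewrite -[leLHS]/(1 + 1) lerD2l mulrA ler_pdivlMr // mul1r -ler_pdivrMr //.
  by apply: ltW; apply: archi_boundP; rewrite divr_ge0 // ltW.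
have [kappa sketches] := sketch_exists a1.
pose base_log := (K + 7)%N; pose M : R := 2 `^ (base_log%:R * c) * 2 `^ (2 * c).
have c0 : 0 < c by apply: lt_trans hc.
have M1 : 1 <= M.
  have p1 y : 0 <= y -> 1 <= 2 `^ y :> R.
    by move=> y0; rewrite -[leLHS](powRr0 2) ler_powR ?ler1n.
  by rewrite -[1]mulr1; apply: ler_pM; rewrite ?p1 // mulr_ge0 // ltW.
exists (10 + 12 * M), (address_exponent base_log kappa), (base_log + 4)%N => n d k dn hk.
set T := _ `^ (c / k%:R); have T0 : 0 <= T by apply: powR_ge0.
have C0 : 0 <= 10 + 12 * M by lra.
have k6 := rounds_ge6 hc hk.
have [d0|d_gt0] := posnP d.
  move: dn @T T0; rewrite d0 => n0 T T0.
  have [S [solS probesS]] := zero_dim_scheme gamma k n0.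
  by exists 0%N, 0%N, S; split; rewrite ?probesS ?muln0 // mulr_ge0 // addr_ge0.
have base_log_ge7 : (7 <= base_log)%N by rewrite /base_log leq_addl.
pose Lam := levels_log base_log d; pose L := (2 ^ Lam)%N.
pose lgn := trunc_log 2 n.
(* The error exponents are those needed to union bound over levels and database points for [sk1],
   and over pairs of levels for [sk2]. *)
have [O1 [sk1 [acc1 [O1_gt0 err1]]]] :=
  sketches d (radius alpha) L (9 + Lam + lgn)%N d_gt0 (radius_gt0 a1).
have [O2 [sk2 [acc2 [O2_gt0 err2]]]] :=
  sketches d (radius alpha) L (10 + 2 * Lam + drop_log base_log n d k)%N d_gt0 (radius_gt0 a1).
have n_gt0 : (0 < n)%N by exact: leq_ltn_trans dn.
have err_near e (O : finType) (sk : sketch_family d (kappa * e) O) acc :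
    (forall i (x z : point d), (i <= L)%N ->
      (2 ^ e * #|[set o |
         ((hdist x z)%:R <= radius alpha i)%R && ~~ acc (sk i o x) (sk i o z)
         || (alpha * radius alpha i < (hdist x z)%:R)%R && acc (sk i o x) (sk i o z)]|
       <= #|O|)%N) ->
    forall i (x z : point d), (i <= L)%N ->
      (2 ^ e * #|[set o | sketch_err (near_at alpha (d := d)) sk acc i o x z]| <= #|O|)%N.
  move=> err i x z iL; apply: leq_trans (err i x z iL).
  rewrite leq_mul //; apply: subset_leq_card; apply/subsetP => o.
  by rewrite !inE /sketch_err /near_at -ltNge radiusS.
have [F F_good] := good_family_exists n_gt0 O1_gt0 O2_gt0
  (err_near _ _ _ _ err1) (err_near _ _ _ _ err2)
  (fine_error_enough base_log n d) (coarse_error_enough base_log n d k) (coins_enough dn).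
pose q := width base_log d k; pose g := phases base_log d k.
have [enc [dec encK]] := word_encoding (None : content d g) (card_content d g).
pose S : randomized_scheme (point d) (database d n) (point d) k _ _ :=
  anns_scheme n L (drop_log base_log n d k) sk1 acc1 sk2 acc2 q k F enc dec.
exists _, _, S; split.
- have top : forall x z : point d, near_at alpha L x z by move=> x z; apply: near_at_top.
  have solved := @anns_scheme_solves d n L (near_at alpha (d := d)) _ _ (drop_log base_log n d k)
    O1 O2 sk1 acc1 sk2 acc2 _ q g k (@near_at_mono R alpha a1 d) top
    Lam (fan_log base_log d k) (shrinks base_log d k) (phases base_log d k) n_gt0 (ltn0Sn _) erefl
    (ltn0Sn _) (width_enough d base_log_ge7 k6) (drops_enough n d base_log_ge7 k6)
    (shrinks_enough d base_log_ge7 k6) (rounds_enough d base_log_ge7 k6) F F_good _ enc dec encK R.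
  apply: solved => x B z l u _.
  by apply: (bracket_correct a1); rewrite a6.
- rewrite total_probes_anns_scheme.
  have hprobes := probes_bound d base_log_ge7 k6.
  have hshrink := shrink_factor_bound hc hk base_log d_gt0; rewrite -/M -/T in hshrink.
  apply: (@le_trans _ _ (2 * (5 * k%:R + 6 * (M * (1 + T))))).
    apply: (@le_trans _ _ (2 * (5 * k + 6 * 2 ^ (levels_log base_log d %/ k./2.-1))%N%:R)).
      by rewrite -natrM ler_nat addnn -mul2n mulnCA leq_pmul2l.
    by rewrite ler_pM2l // natrD !natrM lerD2l ler_pM2l.
  have k1 : 1 <= k%:R :> R by rewrite ler1n; exact: leq_trans k6.
  exact: probes_arith.
- by rewrite card_address; apply: table_size_bound.
- exact: word_size_bound.
Qed.
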